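(* Let $\alpha$ be a composition of $n$ and $\mathscr C:=D_{\alpha,\mathcal C}$. Then $$\mathsf B\big([\,w_0(\mathrm{Des}_L(\mathrm w_{BL}(F_{\mathscr C}^{\rightarrow}))),\ w_1(\mathrm{set}(\mathsf r(\mathscr C)))\,]_L\big)$$ is an injective hull of $\widehat{\mathbf S}_{\alpha,\mathcal C}$.
   Context: Permutations. $n$ is a positive integer, $[n]=\{1,\dots,n\}$, $\mathfrak S_n$ the symmetric group (product = composition of maps; permutations written as words), $s_i=(i,i+1)$, $\ell(\sigma)$ Coxeter length, $w_0$ the longest element. $\mathrm{Des}_L(\sigma)=\{i:\ell(s_i\sigma)<\ell(\sigma)\}$, $\mathrm{Des}_R(\sigma)=\{i:\ell(\sigma s_i)<\ell(\sigma)\}$. $\preceq_L$ has covers $\sigma\prec s_i\sigma$, $i\notin\mathrm{Des}_L(\sigma)$; $[\sigma,\rho]_L$ is the interval for $\preceq_L$. For $S\subseteq[n-1]$, $S^{c}=[n-1]\setminus S$; $w_0(S)$ is the longest element of the subgroup generated by $\{s_i:i\in S\}$; $w_1(S)=w_0w_0(S^c)$ is the longest element of $\{z:\mathrm{Des}_R(z)\subseteq S\}$. For a composition $\alpha=(\alpha_1,\dots,\alpha_l)$ of $n$, $\ell(\alpha)=l$ and $\mathrm{set}(\alpha)=\{\alpha_1,\dots,\alpha_1+\dots+\alpha_{l-1}\}$. Modules. $H_n(0)$ is the unital associative $\mathbb C$-algebra generated by $\pi_1,\dots,\pi_{n-1}$ with $\pi_i^2=\pi_i$, $\pi_i\pi_{i+1}\pi_i=\pi_{i+1}\pi_i\pi_{i+1}$,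 $\pi_i\pi_j=\pi_j\pi_i$ for $|i-j|\ge2$. For a nonempty left weak Bruhat interval $I$, $\mathsf B(I)$ is the left $H_n(0)$-module with basis $I$ and $\pi_i\cdot\gamma=\gamma$ if $i\in\mathrm{Des}_L(\gamma)$; $=0$ if $i\notin\mathrm{Des}_L(\gamma)$, $s_i\gamma\notin I$; $=s_i\gamma$ if $i\notin\mathrm{Des}_L(\gamma)$, $s_i\gamma\in I$. Injective hulls are in the category of finitely generated left $H_n(0)$-modules. Diagrams. Boxes are $(x,y)$ with $x$ = column from the left, $y$ = row from the bottom. For a diagram $D$ with $n$ boxes, $\mathsf r(D)$ lists the numbers of boxes in rows from top to bottom; $F_D^{\rightarrow}$ is the filling placing $1,\dots,n$ along rows left to right, top row first; $\mathrm w_{BL}$ reads each column bottom to top, leftmost column first. $\mathrm{tcd}(\alpha)=\{(j,i):1\le i\le\ell(\alpha),1\le j\le\alpha_i\}$. The module $\widehat{\mathbf S}_{\alpha,\mathcal C}$. A standard Young composition tableau (SYCT) of shape $\alpha$ is a bijective filling $\tau$ of $\mathrm{tcd}(\alpha)$ by $[n]$ with rows increasing left to right, first column increasing bottom to top, and such that for rows $r<r'$ and a column $k$ with $(k+1,r),(k,r')\in\mathrm{tcd}(\alpha)$ and $\tau(k,r')<\tau(k+1,r)$ one has $(k+1,r')\in\mathrm{tcd}(\alpha)$ and $\tau(k+1,r')<\tau(k+1,r)$. Two SYCTs are equivalent if in each column their entries are in the same relative order. The canonical class $\mathcal C$ is the class of the SYCT filled with $1,\dots,n$ along rows left to right, bottom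 row first (thus all columns increase bottom to top). With $\mathrm w_{RB}$ reading each row right to left, bottom row first, $\{\mathrm w_{RB}(\tau):\tau\in\mathcal C\}$ is known to be a left weak Bruhat interval with minimum $w_0(\mathrm{set}(\alpha)^c)$, and the canonical submodule $\widehat{\mathbf S}_{\alpha,\mathcal C}$ (with basis $\mathcal C$) of the Young quasisymmetric Schur module is known to be isomorphic to $\mathsf B(\{\mathrm w_{RB}(\tau):\tau\in\mathcal C\})$; this may be taken as its definition up to isomorphism. The diagram $D_{\alpha,\mathcal C}$. Step 1: for $1\le i\le\ell(\alpha)$ let $X_i=\{(1,i),\dots,(\alpha_i,i)\}$. Step 2: let $\mathsf{BB}(\alpha)\subseteq\mathrm{tcd}(\alpha)$ consist of the boxes $(1,y)$ with $1\le y<\ell(\alpha)$ and $\alpha_y>1$, the box $(1,\ell(\alpha))$, and the boxes $(x,y)$ with $x>1$ such that no box of $\mathrm{tcd}(\alpha)$ in column $x$ or column $x-1$ lies strictly above row $y$. Order $\mathsf{BB}(\alpha)$ by column index, and within column $1$ by row index, as $(b_1,d_1),\dots,(b_l,d_l)$ in increasing order (so $b_1=1$). Step 3: $Y_1=\{(1,d_1),(1,d_1-1),\dots,(1,1)\}$ and $A_1=\mathrm{tcd}(\alpha)\setminus Y_1$. Step 4: for $j=1,\dots,l-1$ build $Y_{j+1}$: (i) start with the list $(1,d_{j+1}),(1,d_{j+1}-1),\dots,(1,d_j+1)$ if $b_{j+1}=1$, and with the single box $(b_{j+1},d_{j+1})$ otherwise; (ii) let $\kappa$ be the last box in the list, in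 column $c$; if $A_j$ (minus boxes already put in $Y_{j+1}$) contains a box in column $c+1$ strictly below $\kappa$, append the lowermost such box to $Y_{j+1}$ and repeat (ii); otherwise stop. Put $A_{j+1}=A_j\setminus Y_{j+1}$. Step 5: $D_{\alpha,\mathcal C}=\{(i,j):X_i\cap Y_j\ne\emptyset\}$. *)

(* Defs.v *)
From HB Require Import structures.
From mathcomp Require Import all_boot all_order all_fingroup all_algebra.
From mathcomp Require Import boolp.

Set Implicit Arguments.
Unset Strict Implicit.
Unset Printing Implicit Defensive.

Import GRing.Theory.

(* The symmetric group on n.+1 letters is ['S_n.+1], acting on {0, .., n}, and
   the index set of its simple transpositions is ['I_n]: the ordinal of value k
   stands for the generator of index k + 1 in the 1-based convention. *)

Section Permutations.
Variable n : nat.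
Implicit Types (s r : 'S_n.+1) (S : {set 'I_n}).

(* [(x * y)%g] applies x first; [pcomp s r] is the composite of maps s o r. *)
Definition pcomp s r : 'S_n.+1 := (r * s)%g.

(* It exchanges the points of values i and i + 1. *)
Definition simple (i : 'I_n) : 'S_n.+1 :=
  tperm (widen_ord (leqnSn n) i) (lift ord0 i).

Definition oneline s : seq nat := [seq (s k).+1 | k <- enum 'I_n.+1].

(* The identity is a junk value, used only if w is not the one-line notation of
   a permutation (see [perm_of_wordK]). *)
Definition perm_of_word (w : seq nat) : 'S_n.+1 :=
  odflt 1%g [pick s | oneline s == w].

Definition simple_prod (t : seq 'I_n) : 'S_n.+1 :=
  foldr (fun i s => pcomp (simple i) s) 1%g t.

Lemma simple_prod_rcons t i :
  simple_prod (rcons t i) = pcomp (simple_prod t) (simple i).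
Proof.
elim: t => [|j t IHt] /=; first by rewrite /pcomp mulg1 mul1g.
by rewrite IHt /pcomp mulgA.
Qed.

Lemma gen_simple : (<<[set simple i | i : 'I_n]>> = [set: 'S_n.+1])%g.
Proof.
apply/eqP; rewrite eqEsubset subsetT /= -(gen_tperm (@ord0 n)) gen_subG.
apply/subsetP=> _ /imsetP[y _ ->].
case: y => k; elim: k => [|k IHk] lt_k.
  by rewrite (_ : Ordinal lt_k = ord0) ?tperm1 ?group1 //; apply: val_inj.
have lt_kn : k < n by [].
have ltk' : k < n.+1 by apply: ltnW.
have sg : simple (Ordinal lt_kn) \in <<[set simple i | i : 'I_n]>>%g.
  by apply: mem_gen; apply: imset_f.
case: (posnP k) => [k0|k_gt0].
  rewrite (_ : tperm _ _ = simple (Ordinal lt_kn)) //.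
  by congr (tperm _ _); apply: val_inj => /=; rewrite ?k0.
rewrite (_ : tperm _ _ =
           (tperm ord0 (Ordinal ltk') ^ simple (Ordinal lt_kn))%g).
  by rewrite groupJ ?IHk.
rewrite tpermJ; congr (tperm _ _).
  by rewrite /simple tpermD //; apply/eqP=> /(congr1 val) /= ?; subst k.
rewrite /simple (_ : Ordinal ltk' = widen_ord (leqnSn n) (Ordinal lt_kn));
  last exact: val_inj.
by rewrite tpermL; apply: val_inj.
Qed.

Lemma simple_prod_ex s :
  exists k, [exists t : k.-tuple 'I_n, simple_prod t == s].
Proof.
have: s \in <<[set simple i | i : 'I_n]>>%g by rewrite gen_simple inE.
case/gen_prodgP=> k [c Hc ->].
have: exists t : seq 'I_n, simple_prod t = (\prod_i c i)%g.
  elim: k c Hc => [|k IHk] c Hc; first by exists [::]; rewrite big_ord0.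
  case: (IHk (fun i => c (lift ord0 i))) => [i|t Ht]; first exact: Hc.
  case/imsetP: (Hc ord0) => j _ Hj.
  by exists (rcons t j); rewrite big_ord_recl simple_prod_rcons Ht Hj.
by case=> t Ht; exists (size t); apply/existsP; exists (in_tuple t); apply/eqP.
Qed.

Definition coxeter_length s : nat := ex_minn (simple_prod_ex s).

Definition DesL s : {set 'I_n} :=
  [set i | coxeter_length (pcomp (simple i) s) < coxeter_length s].

Definition leL : rel 'S_n.+1 :=
  connect (fun s r => [exists i, (i \notin DesL s) && (r == pcomp (simple i) s)]).

Definition intervalL s r : {set 'S_n.+1} := [set g | leL s g && leL g r].

Definition w0 S : 'S_n.+1 :=
  [arg max_(s > 1%g in <<[set simple i | i in S]>>%g) coxeter_length s].

Definition w1 S : 'S_n.+1 := pcomp (w0 [set: 'I_n]) (w0 (~: S)).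

Lemma perm_of_wordK w : perm_eq w (iota 1 n.+1) -> oneline (perm_of_word w) = w.
Proof.
move=> pw; rewrite /perm_of_word; case: pickP => [s /eqP //|no_s].
have szw : size w = n.+1 by rewrite (perm_size pw) size_iota.
have uw : uniq w by rewrite (perm_uniq pw) iota_uniq.
have bw (k : 'I_n.+1) : 0 < nth 0 w k <= n.+1.
  have : nth 0 w k \in w by rewrite mem_nth ?szw.
  by rewrite (perm_mem pw) mem_iota add1n ltnS.
pose f (k : 'I_n.+1) : 'I_n.+1 := inord (nth 0 w k).-1.
have fE k : (f k).+1 = nth 0 w k.
  case/andP: (bw k) => w_gt0 w_le.
  by rewrite /f inordK ?prednK.
have f_inj : injective f.
  move=> k l /(congr1 (fun x : 'I_n.+1 => x.+1)); rewrite !fE => /eqP.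
  by rewrite nth_uniq ?szw // => /eqP /val_inj.
have := no_s (perm f_inj); case/eqP.
apply: (@eq_from_nth _ 0); first by rewrite size_map size_enum_ord szw.
move=> i; rewrite size_map size_enum_ord => lt_i.
rewrite (nth_map ord0) ?size_enum_ord // permE fE.
by rewrite nth_enum_ord.
Qed.

End Permutations.

Definition is_composition (m : nat) (alpha : seq nat) : bool :=
  all (leq 1) alpha && (sumn alpha == m).

(* The set of proper partial sums of a composition of n.+1 *)
Definition comp_set (n : nat) (alpha : seq nat) : {set 'I_n} :=
  [set i : 'I_n | i.+1 \in [seq sumn (take k alpha) | k <- iota 1 (size alpha).-1]].

(* A left module over the algebra presented by the generators pi_i and the
   0-Hecke relations is a vector space with linear operators pi_i satisfying
   these relations; [is_H0_module] is this condition. *)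

Record preH0Module (F : fieldType) (n : nat) := PreH0Module {
  H0carrier :> lmodType F;
  H0pi : 'I_n -> H0carrier -> H0carrier }.

Section Modules.
Variables (F : fieldType) (n : nat).
Local Open Scope ring_scope.
Implicit Types M N E : preH0Module F n.

Definition is_H0_module M : Prop :=
  [/\ forall i, linear (@H0pi _ _ M i),
      forall i (v : M), H0pi i (H0pi i v) = H0pi i v,
      forall (i j : 'I_n) (v : M), (j = i.+1 :> nat)%N ->
        H0pi i (H0pi j (H0pi i v)) = H0pi j (H0pi i (H0pi j v))
    & forall (i j : 'I_n) (v : M), ((i.+1 < j) || (j.+1 < i))%N ->
        H0pi i (H0pi j v) = H0pi j (H0pi i v)].

Definition is_submodule M (U : M -> Prop) : Prop :=
  [/\ U 0,
      forall (a : F) u v, U u -> U v -> U (a *: u + v)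
    & forall i u, U u -> U (H0pi i u)].

Definition finitely_generated M : Prop :=
  exists gens : seq M, forall U : M -> Prop,
    is_submodule U -> {in gens, forall v, U v} -> forall v, U v.

Definition is_fg_module M : Prop := is_H0_module M /\ finitely_generated M.

Definition is_hom M N (f : M -> N) : Prop :=
  linear f /\ forall i v, f (H0pi i v) = H0pi i (f v).

(* Injective object of the category of finitely generated modules *)
Definition injective_module E : Prop :=
  forall M N (f : M -> N) (g : M -> E),
    is_fg_module M -> is_fg_module N ->
    is_hom f -> injective f -> is_hom g ->
    exists2 h : N -> E, is_hom h & forall v, h (f v) = g v.

Definition essential M E (f : M -> E) : Prop :=
  forall U : E -> Prop, is_submodule U -> (exists2 u, U u & u != 0) ->
    exists2 v, U (f v) & f v != 0.

Definition is_injective_hull E M : Prop :=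
  [/\ is_fg_module M, is_fg_module E, injective_module E
    & exists f : M -> E, [/\ is_hom f, injective f & essential f]].

Section WeakBruhatIntervalModule.
Variable I : {set 'S_n.+1}.

(* The vector space with basis I *)
Definition B_space : lmodType F := {ffun {g : 'S_n.+1 | g \in I} -> F^o}.

(* The basis vector g when g \in I, and 0 when g \notin I *)
Definition B_basis (g : 'S_n.+1) : B_space := [ffun x => (val x == g)%:R].

Definition B_act (i : 'I_n) (g : 'S_n.+1) : B_space :=
  if i \in DesL g then B_basis g
  else if pcomp (simple i) g \notin I then 0
  else B_basis (pcomp (simple i) g).

Definition B_pi (i : 'I_n) (v : B_space) : B_space :=
  \sum_x (v : {ffun _ -> F^o}) x *: B_act i (val x).

Definition B : preH0Module F n := PreH0Module B_pi.

End WeakBruhatIntervalModule.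
End Modules.

Arguments B F {n} I.

(* A box is a pair (column, row), both counted from 1; rows are counted from the
   bottom.  A diagram is a duplicate-free list of boxes, and only the values of
   a filling on the boxes of its diagram matter. *)

Notation box := (nat * nat)%type.
Notation filling := (box -> nat).

Definition row_order : rel box :=
  fun b c => (c.2 < b.2) || ((b.2 == c.2) && (b.1 <= c.1)).

Definition column_order : rel box :=
  fun b c => (b.1 < c.1) || ((b.1 == c.1) && (b.2 <= c.2)).

(* The numbers of boxes in the (nonempty) rows, from top to bottom *)
Definition row_counts (D : seq box) : seq nat :=
  [seq count (fun b => b.2 == y) D | y <- sort geq (undup [seq b.2 | b <- D])].

(* The boxes of D are numbered from 1 along the rows, left to right, top row
   first. *)
Definition row_filling (D : seq box) : filling :=
  fun b => (index b (sort row_order D)).+1.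

(* Each column is read from bottom to top, leftmost column first. *)
Definition word_BL (D : seq box) (t : filling) : seq nat :=
  [seq t b | b <- sort column_order D].

Section Tableaux.
Variable alpha : seq nat.

(* The part of index i, counted from 1 *)
Definition part (i : nat) : nat := nth 0 alpha i.-1.

(* Listed along the rows, left to right, bottom row first *)
Definition tcd : seq box :=
  [seq (j, i) | i <- iota 1 (size alpha), j <- iota 1 (part i)].

Definition is_SYCT (t : filling) : Prop :=
  [/\ perm_eq [seq t b | b <- tcd] (iota 1 (sumn alpha)),
      forall x x' y, (x, y) \in tcd -> (x', y) \in tcd -> x < x' ->
        t (x, y) < t (x', y),
      forall y y', (1, y) \in tcd -> (1, y') \in tcd -> y < y' ->
        t (1, y) < t (1, y')
    & forall r r' k, r < r' -> (k.+1, r) \in tcd -> (k, r') \in tcd ->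
        t (k, r') < t (k.+1, r) ->
        (k.+1, r') \in tcd /\ t (k.+1, r') < t (k.+1, r)].

Definition SYCT_equiv (t t' : filling) : Prop :=
  forall x y y', (x, y) \in tcd -> (x, y') \in tcd ->
    (t (x, y) < t (x, y')) = (t' (x, y) < t' (x, y')).

Definition canonical_filling : filling := fun b => (index b tcd).+1.

Definition in_canonical_class (t : filling) : Prop :=
  is_SYCT t /\ SYCT_equiv t canonical_filling.

(* Each row is read from right to left, bottom row first. *)
Definition word_RB (t : filling) : seq nat :=
  [seq t (j, i) | i <- iota 1 (size alpha), j <- rev (iota 1 (part i))].

Definition canonical_words (n : nat) : {set 'S_n.+1} :=
  [set s : 'S_n.+1 |
    `[< exists2 t : filling, in_canonical_class t & oneline s = word_RB t >]].

(* The canonical submodule of the Young quasisymmetric Schur module, up to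
   isomorphism *)
Definition S_hat (F : fieldType) (n : nat) : preH0Module F n :=
  B F (canonical_words n).

Definition row_boxes (i : nat) : seq box := [seq (x, i) | x <- iota 1 (part i)].

Definition in_BB (b : box) : bool :=
  if b.1 == 1 then (b.2 == size alpha) || (1 < part b.2)
  else ~~ has (fun c => ((c.1 == b.1) || (c.1 == b.1.-1)) && (b.2 < c.2)) tcd.

Definition BB : seq box := sort column_order [seq b <- tcd | in_BB b].

(* The boxes that can be appended to the list Y, in increasing row order: they
   all lie in the column that follows that of the last box of Y. *)
Definition next_boxes (A Y : seq box) : seq box :=
  let kappa := last (0, 0) Y in
  sort (fun b c => b.2 <= c.2)
    [seq b <- A | [&& b \notin Y, b.1 == kappa.1.+1 & b.2 < kappa.2]].

(* [size A] is enough fuel, since each step uses up a box of A. *)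
Fixpoint extend_chain (fuel : nat) (A Y : seq box) : seq box :=
  if fuel is fuel'.+1 then
    if next_boxes A Y is b :: _ then extend_chain fuel' A (rcons Y b) else Y
  else Y.

(* The list (1, d), (1, d - 1), .., (1, d' + 1) *)
Definition first_column_boxes (d d' : nat) : seq box :=
  [seq (1, y) | y <- rev (iota d'.+1 (d - d'))].

(* The lists Y_{j+1}, Y_{j+2}, .., where A and d' stand for A_j and d_j, and bs
   is the list of the (b_k, d_k) for k > j *)
Fixpoint chains (A : seq box) (d' : nat) (bs : seq box) : seq (seq box) :=
  if bs is (b, d) :: bs' then
    let Y := extend_chain (size A) A
               (if b == 1 then first_column_boxes d d' else [:: (b, d)]) in
    Y :: chains [seq c <- A | c \notin Y] d bs'
  else [::].

Definition Ys : seq (seq box) :=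
  if BB is (_, d) :: bs then
    let Y := first_column_boxes d 0 in
    Y :: chains [seq c <- tcd | c \notin Y] d bs
  else [::].

Definition canonical_diagram : seq box :=
  [seq b <- [seq (i, j) | i <- iota 1 (size alpha), j <- iota 1 (size Ys)]
   | has (mem (row_boxes b.1)) (nth [::] Ys b.2.-1)].

End Tableaux.

(* Main.v *)
From HB Require Import structures.
From mathcomp Require Import complex reals.
From mathcomp Require boolp classical_sets.
From mathcomp Require Import all_boot all_order all_fingroup all_algebra.
From mathcomp Require Import zify.
Require Import Defs.

Set Implicit Arguments.
Unset Strict Implicit.
Unset Printing Implicit Defensive.

Import GRing.Theory.

(* Give the box of tcd(alpha) in row x that lies in the chain Y_j the coordinates
   (x, j): these points form the diagram D.  A filling belongs to the canonical
   class iff it increases along the product order on D, and D has no two points,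
   one strictly above and to the right of the other, with nothing in between.
   Reading D along its rows instead of along the rows of tcd(alpha) therefore
   embeds S_hat into the module E on the z with A <= Des_R(z) <= B, where B is the
   set of the ends of the rows of D, and A that of the ends p with
   (column of point p + 1) <= (column of point p).

   E is injective.  A homomorphism N -> H_n(0) amounts to an arbitrary linear
   functional on N, its coefficient at w_0, so H_n(0) is injective; and E is a
   retract of H_n(0): right multiplication by the antisymmetrizer of the Young
   subgroup of B^c maps E to H_n(0), right multiplication by pi_{w_0(A)} maps
   H_n(0) back to E, and the composite is unipotent.

   The extension is essential.  The support of a common eigenvector u of the pi_i
   in E is stable under the s_i with pi_i u = 0, as long as they stay in E, and
   consists of z with descent i if pi_i u = u.  Moving values with such s_i shows
   that every z in it takes larger values before a cut d in A than after it, and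
   such z come from the canonical class. *)

(** * Inversions and the left weak order *)

(** Why A is read off from columns: if one point of D lies in a lower row than another and not to
    its right, the columns cannot strictly increase at every step of the row reading from the higher
    point to the lower one, so a cut of A lies between them. Correct order across the cuts of A and
    increasing rows therefore force monotonicity on all of D. Why translation by one permutation is
    enough: reading D along its rows, or along its columns from top to bottom, orders two points
    differently only when one is strictly above and to the right of the other, and in a filling of
    the class such points never carry consecutive values. The obstacle on the side of the chains is
    that they are built greedily and one after the other, while the proof needs the number of the
    chain through a given box; hence the recursion [root], which walks from a box back to the start
    of its chain, and the monotonicity of the resulting index in rows and columns. *)

Section Inversions.
Variable n : nat.
Implicit Types (s r z : 'S_n.+1) (i j : 'I_n) (p q : 'I_n.+1).

Definition lo i : 'I_n.+1 := widen_ord (leqnSn n) i.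
Definition hi i : 'I_n.+1 := lift ord0 i.
(** Pairs of positions, not of values: left multiplication by s_i then changes the status of a
    single pair, and [leL] becomes inclusion. *)
Definition inversions s : {set 'I_n.+1 * 'I_n.+1} :=
[set pq : 'I_n.+1 * 'I_n.+1 | (pq.1 < pq.2) && (s pq.2 < s pq.1)].
Definition swap i s : 'S_n.+1 := pcomp (simple i) s.

Lemma lo_val i : lo i = i :> nat. Proof. by []. Qed.
Lemma hi_val i : hi i = i.+1 :> nat. Proof. by rewrite /hi lift0. Qed.
Lemma lo_hi i : lo i < hi i. Proof. by rewrite hi_val. Qed.

Lemma ord_eqE p q : (p == q) = (p == q :> nat). Proof. by []. Qed.

Lemma simpleE i p : simple i p = (if p == lo i then hi i else if p == hi i then lo i else p).
Proof. by rewrite permE. Qed.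

Lemma simple_lt i p q :
(simple i p < simple i q) =
if (p == lo i) && (q == hi i) then false
else if (p == hi i) && (q == lo i) then true else p < q.
Proof.
rewrite !simpleE !ord_eqE lo_val hi_val.
do ![case: eqP => ? /=]; rewrite ?lo_val ?hi_val /bump; lia.
Qed.

Lemma swapE i s p : swap i s p = simple i (s p). Proof. exact: permM. Qed.

Lemma simpleK i : involutive (simple i).
Proof. by move=> p; rewrite /simple tpermK. Qed.

Lemma swapK i : involutive (swap i).
Proof. by move=> s; apply/permP => p; rewrite !swapE simpleK. Qed.

Lemma simpleV i : ((simple i)^-1 = simple i)%g. Proof. exact: tpermV. Qed.

Lemma swapV i s p : ((swap i s)^-1)%g p = (s^-1)%g (simple i p).
Proof. by rewrite /swap /pcomp invMg permM simpleV. Qed.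

Lemma simple_lo i : simple i (lo i) = hi i. Proof. exact: tpermL. Qed.
Lemma simple_hi i : simple i (hi i) = lo i. Proof. exact: tpermR. Qed.

Definition desL i s := (s^-1)%g (hi i) < (s^-1)%g (lo i).

Lemma desL_swap i s : desL i (swap i s) = ~~ desL i s.
Proof.
rewrite /desL !swapV simple_lo simple_hi -leqNgt [RHS]leq_eqVlt.
case: eqP => // /ord_inj /perm_inj /(congr1 (@nat_of_ord _)).
by rewrite lo_val hi_val; lia.
Qed.

Lemma eq_permV s p q : (s p == q) = (p == (s^-1)%g q).
Proof. by rewrite -[RHS](inj_eq (@perm_inj _ s)) permKV. Qed.

Lemma inversions_swap i s : ~~ desL i s ->
inversions (swap i s) = ((s^-1)%g (lo i), (s^-1)%g (hi i)) |: inversions s /\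
((s^-1)%g (lo i), (s^-1)%g (hi i)) \notin inversions s.
Proof.
rewrite /desL => nd; split; last first.
by rewrite inE /= !permKV !lo_val hi_val; lia.
have ne : (s^-1)%g (lo i) < (s^-1)%g (hi i).
by have := desL_swap i s; rewrite /desL nd !swapV simple_lo simple_hi.
apply/setP => -[p q]; rewrite !inE /= !swapE simple_lt !eq_permV xpair_eqE.
have sa := permKV s (lo i); have sb := permKV s (hi i).
move: sa sb ne; set a := (s^-1)%g (lo i); set b := (s^-1)%g (hi i) => sa sb ne.
case: ifP => [/andP[/eqP -> /eqP ->]|_].
  have -> : (b == a) = false by apply/eqP => ba; rewrite ba ltnn in ne.
  by rewrite andbF ltnNge (ltnW ne).
case: ifP => [/andP[/eqP -> /eqP ->]|nab]; first by rewrite ne !eqxx.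
by rewrite [(p == a) && _]andbC nab.
Qed.

Lemma inversions1 : inversions (1%g : 'S_n.+1) = set0.
Proof. by apply/setP => -[p q]; rewrite !inE !perm1 /=; apply/negbTE; lia. Qed.

Lemma card_inversions_swap i s :
  #|inversions (swap i s)| =
  if desL i s then #|inversions s|.-1 else #|inversions s|.+1.
Proof.
case: ifPn => d; last first.
  by have [-> ?] := inversions_swap d; rewrite cardsU1; lia.
have d' : ~~ desL i (swap i s) by rewrite desL_swap d.
have [E ?] := inversions_swap d'; rewrite swapK in E.
by rewrite E cardsU1; lia.
Qed.

Lemma card_inversions_desL i s : desL i s -> 0 < #|inversions s|.
Proof.
move=> d; apply/card_gt0P; exists ((s^-1)%g (hi i), (s^-1)%g (lo i)).
by move: d; rewrite inE /= /desL => ->; rewrite !permKV lo_hi.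
Qed.

(** If no such i existed, the composite of the inverse of [s] with [r] would increase on all
    consecutive values, hence be the identity. *)
Lemma desL_ex s r : s != r -> inversions s \subset inversions r ->
  exists2 i, ~~ desL i s & ((s^-1)%g (lo i), (s^-1)%g (hi i)) \in inversions r.
Proof.
move=> ne sub.
case: (pickP (fun i => ~~ desL i s &&
  (((s^-1)%g (lo i), (s^-1)%g (hi i)) \in inversions r))) => [i /andP[]|none].
  by exists i.
have step i : r ((s^-1)%g (lo i)) < r ((s^-1)%g (hi i)).
  have := none i; case: (boolP (desL i s)) => /= d.
    move=> _; have /(subsetP sub) : ((s^-1)%g (hi i), (s^-1)%g (lo i)) \in inversions s.
      by move: d; rewrite inE /= /desL => ->; rewrite !permKV lo_hi.
    by rewrite inE /= => /andP[].
  rewrite inE /= => /negbT; rewrite negb_and -!leqNgt => /orP[].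
    move: d; rewrite /desL -leqNgt => le1 le2.
    have /eqP : (s^-1)%g (lo i) = (s^-1)%g (hi i) :> nat by apply/eqP; rewrite eqn_leq le1 le2.
    rewrite -ord_eqE (inj_eq perm_inj) => /eqP /(congr1 (@nat_of_ord _)).
    by rewrite lo_val hi_val; lia.
  rewrite leq_eqVlt => /orP[|//]; rewrite -ord_eqE !(inj_eq perm_inj).
  by move=> /eqP /(congr1 (@nat_of_ord _)); rewrite lo_val hi_val; lia.
(* [ge] climbs from 0 and [le] descends from n; together they squeeze the increasing map to the
   identity. *)
have ge k (kn : k < n.+1) : k <= r ((s^-1)%g (Ordinal kn)).
  elim: k kn => // k IHk kn; have kn' : k < n.+1 by apply: ltnW.
  have kn2 : k < n by [].
  have := step (Ordinal kn2); have := IHk kn'.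
  rewrite (_ : lo _ = Ordinal kn'); last exact: val_inj.
  rewrite (_ : hi _ = Ordinal kn); last by apply: ord_inj; rewrite hi_val.
  by lia.
have le d k (kn : k < n.+1) : k + d = n -> r ((s^-1)%g (Ordinal kn)) <= k.
  elim: d k kn => [|d IHd] k kn kd; first by have := ltn_ord (r ((s^-1)%g (Ordinal kn))); lia.
  have kn1 : k.+1 < n.+1 by lia.
  have kn2 : k < n by lia.
  have := step (Ordinal kn2); have := IHd _ kn1.
  rewrite (_ : lo _ = Ordinal kn); last exact: val_inj.
  rewrite (_ : hi _ = Ordinal kn1); last by apply: ord_inj; rewrite hi_val.
  by lia.
case/eqP: ne; apply/permP => p; rewrite -{2}(permK s p); case: (s p) => k kn.
apply: ord_inj => /=; have := ge k kn; have := @le (n - k) k kn.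
by lia.
Qed.

(** Descending induction from [r]: by [desL_ex], every s strictly below [r] has an upper cover that
    is still below [r]. *)
Lemma inversions_ind r (P : 'S_n.+1 -> Prop) : P r ->
  (forall s i, ~~ desL i s -> inversions (swap i s) \subset inversions r ->
     P (swap i s) -> P s) ->
  forall s, inversions s \subset inversions r -> P s.
Proof.
move=> Pr Pstep s.
move: {2}(#|inversions r| - #|inversions s|) (erefl (#|inversions r| - #|inversions s|)) => m.
elim: m s => [|m IHm] s sm sub; have [-> //|ne] := eqVneq s r;
  have [i di pi] := desL_ex ne sub; have [E nE] := inversions_swap di;
  have sub' : inversions (swap i s) \subset inversions r
    by rewrite E subUset sub1set pi.
  by have := subset_leq_card sub'; rewrite E cardsU1 nE; lia.
apply: (Pstep _ _ di sub'); apply: IHm => //.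
by rewrite E cardsU1 nE; lia.
Qed.

Lemma simple_prod_cons i t : simple_prod (i :: t) = swap i (simple_prod t).
Proof. by []. Qed.

Lemma coxeter_lengthE s : coxeter_length s = #|inversions s|.
Proof.
rewrite /coxeter_length; case: ex_minnP => m /existsP[t /eqP ts] min.
apply/eqP; rewrite eqn_leq; apply/andP; split; last first.
  rewrite -ts -[X in _ <= X](size_tuple t) {ts min}.
  suff le (t' : seq 'I_n) : #|inversions (simple_prod t')| <= size t' by exact: le.
  elim: t' => [|i t' IHt]; first by rewrite inversions1 cards0.
  rewrite simple_prod_cons card_inversions_swap; case: ifP => _ /=; last exact: IHt.
  exact: leq_trans (leq_pred _) (leqW IHt).
apply: min; apply/existsP.
suff [t' [<- <-]] : exists t' : seq 'I_n,
    size t' = #|inversions s| /\ simple_prod t' = s by exists (in_tuple t').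
(* The factorisation of [s] with additive lengths is proved for every right factor z below [s],
   starting from z = [s], and is used at z = 1. *)
suff : exists t', size t' + #|inversions (1%g : 'S_n.+1)| = #|inversions s|
    /\ pcomp (simple_prod t') 1%g = s.
  by case=> t'; rewrite inversions1 cards0 addn0 /pcomp mul1g; exists t'.
apply: (@inversions_ind s (fun z => exists t', size t' + #|inversions z| =
    #|inversions s| /\ pcomp (simple_prod t') z = s)).
- by exists [::]; rewrite /pcomp mulg1.
- move=> z i d _ [t' [sz e]]; exists (rcons t' i); split.
    by move: sz; rewrite card_inversions_swap (negbTE d) size_rcons; lia.
  by rewrite simple_prod_rcons -e /pcomp -mulgA.
- by rewrite inversions1 sub0set.
Qed.

Lemma mem_DesL i s : (i \in DesL s) = desL i s.
Proof.
rewrite inE !coxeter_lengthE -/(swap i s) card_inversions_swap.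
by case: ifP => [/card_inversions_desL|]; lia.
Qed.

Lemma leLE s r : leL s r = (inversions s \subset inversions r).
Proof.
apply/idP/idP => [/connectP[p]|].
  elim: p s => [|z p IHp] s /=; first by move=> _ ->.
  case/andP => /existsP[k]; rewrite mem_DesL => /andP[d /eqP zE] pp lp.
  apply: subset_trans (IHp z pp lp); rewrite zE -/(swap k s).
  by have [-> _] := inversions_swap d; rewrite subsetUr.
move: s; apply: inversions_ind; first exact: connect0.
move=> s i d _; apply: connect_trans; apply: connect1.
by apply/existsP; exists i; rewrite mem_DesL d eqxx.
Qed.

Lemma inversionsP s p q :
  reflect (p < q /\ s q < s p) ((p, q) \in inversions s).
Proof. by rewrite inE; apply: andP. Qed.

Lemma card_inversionsV s : #|inversions (s^-1)%g| = #|inversions s|.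
Proof.
have le z : #|inversions z| <= #|inversions (z^-1)%g|.
  have inj : injective (fun pq : 'I_n.+1 * 'I_n.+1 => (z pq.2, z pq.1)).
    by case=> p q [p' q'] [] /perm_inj /= -> /perm_inj /= ->.
  rewrite -(card_imset _ inj); apply: subset_leq_card; apply/subsetP => x.
  by case/imsetP => -[p q] /inversionsP[pq zqp] ->; apply/inversionsP; rewrite /= !permK.
by apply/eqP; rewrite eqn_leq le -{2}(invgK s) le.
Qed.

Lemma parabolic_stable (S : {set 'I_n}) j z p : j \notin S ->
  z \in <<[set simple i | i in S]>>%g -> (z p <= j) = (p <= j).
Proof.
move=> jS /gen_prodgP[m [c Hc ->]]; move: p.
pose K (x : 'S_n.+1) := forall p, (x p <= j) = (p <= j).
apply: (@big_ind _ K) => [p|x y Kx Ky p|i _]; first by rewrite perm1.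
  by rewrite permM Ky Kx.
have /imsetP[k kS ->] := Hc i; move=> p; rewrite simpleE !ord_eqE.
have kj : k != j by apply: contraNneq jS => <-.
have {}kj : k != j :> nat by [].
by case: eqP => [->|_]; [|case: eqP => [->|//]]; rewrite lo_val hi_val; lia.
Qed.

(** A longest element cannot be lengthened by s_j on the right; passing to inverses turns this into
    a left multiplication, which [card_inversions_swap] measures. *)
Lemma desR_w0 (S : {set 'I_n}) j : j \in S -> w0 S (hi j) < w0 S (lo j).
Proof.
rewrite /w0; case: arg_maxnP => [|s sS max jS]; first exact: group1.
have : (simple j * s)%g \in <<[set simple i | i in S]>>%g.
  by rewrite groupM // mem_gen // imset_f.
move=> /max; rewrite !coxeter_lengthE -(card_inversionsV (simple j * s)%g) invMg simpleV -/(pcomp _ _).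
rewrite -/(swap _ _) card_inversions_swap card_inversionsV /desL invgK.
by case: ifP => // _; rewrite /geq /= ltnn.
Qed.

Lemma w0_gen (S : {set 'I_n}) : w0 S \in <<[set simple i | i in S]>>%g.
Proof. by rewrite /w0; case: arg_maxnP => [|//]; exact: group1. Qed.

Lemma ord_chain (f : 'I_n.+1 -> nat) p q : p < q ->
  (forall j : 'I_n, p <= j < q -> f (lo j) < f (hi j)) -> f p < f q.
Proof.
case: q => q qn /=; elim: q qn => // q IHq qn pq df.
have qn' : q < n.+1 by apply: ltnW.
have jn : q < n by [].
have := df (Ordinal jn); rewrite (_ : lo _ = Ordinal qn'); last exact: val_inj.
rewrite (_ : hi _ = Ordinal qn); last by apply: ord_inj; rewrite hi_val.
rewrite /= ltnS leqnn andbT -ltnS pq => /(_ isT) lt1.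
move: pq; rewrite ltnS leq_eqVlt => /orP[/eqP pq|pq].
  by rewrite (_ : p = Ordinal qn') //; apply: ord_inj.
apply: ltn_trans (IHq qn' pq _) lt1 => j /andP[pj jq]; apply: df.
by rewrite pj ltnS ltnW.
Qed.

Lemma ascR_chain z p q : p < q ->
  (forall j : 'I_n, p <= j < q -> z (lo j) < z (hi j)) -> z p < z q.
Proof. exact: (@ord_chain (fun x => z x)). Qed.

Lemma desR_chain z p q : p < q ->
  (forall j : 'I_n, p <= j < q -> z (hi j) < z (lo j)) -> z q < z p.
Proof.
move=> pq dz; have := @ord_chain (fun x => n.+1 - z x) p q pq.
have lt x : z x < n.+1 by exact: ltn_ord.
have h : forall j : 'I_n, p <= j < q -> n.+1 - z (lo j) < n.+1 - z (hi j).
  by move=> j /dz; have := lt (lo j); lia.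
by move=> /(_ h); have := lt p; lia.
Qed.

Lemma inversions_w0 (S : {set 'I_n}) p q :
  reflect (p < q /\ forall j : 'I_n, p <= j < q -> j \in S)
          ((p, q) \in inversions (w0 S)).
Proof.
apply: (iffP (inversionsP _ _ _)) => -[pq H]; split=> //; last first.
  by apply: desR_chain pq _ => j /H; exact: desR_w0.
move=> j /andP[pj jq]; apply: contraLR H => jS.
have := parabolic_stable p jS (w0_gen S); have := parabolic_stable q jS (w0_gen S).
by move=> e1 e2; lia.
Qed.

(** Composing with the order-reversing w_0 complements the inversion set of w_0(S^c) among the pairs
    p < q. *)
Lemma inversions_w1 (S : {set 'I_n}) p q :
  reflect (p < q /\ exists2 j : 'I_n, p <= j < q & j \in S)
          ((p, q) \in inversions (w1 S)).
Proof.
have rev (x y : 'I_n.+1) : x < y -> w0 [set: 'I_n] y < w0 [set: 'I_n] x.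
  by move=> xy; apply: desR_chain xy _ => j _; apply: desR_w0; rewrite inE.
have revE (x y : 'I_n.+1) : (w0 [set: 'I_n] x < w0 [set: 'I_n] y) = (y < x).
  case: (ltngtP x y) => [/rev|/rev ->//|/ord_inj ->]; last by rewrite ltnn.
  by move/ltnW; rewrite leqNgt => /negbTE.
apply: (iffP (inversionsP _ _ _)) => -[pq].
  rewrite /w1 /pcomp !permM revE => lt; split=> //.
  case: (pickP (fun j : 'I_n => (p <= j < q) && (j \in S))) => [j /andP[]|none].
    by exists j.
  have /inversionsP[_] : (p, q) \in inversions (w0 (~: S)).
    apply/inversions_w0; split=> // j pjq; have := none j.
    by rewrite pjq /= inE => ->.
  by rewrite ltnNge (ltnW lt).
move=> [j pjq jS]; split=> //; rewrite /w1 /pcomp !permM revE.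
rewrite ltnNge leq_eqVlt negb_or; apply/andP; split.
  rewrite -ord_eqE (inj_eq perm_inj); apply/eqP => qp; rewrite qp ltnn in pq *; by lia.
apply/negP => lt; have /inversions_w0[_ /(_ _ pjq)] : (p, q) \in inversions (w0 (~: S)).
  by apply/inversionsP.
by rewrite inE jS.
Qed.

End Inversions.

(** * Intervals as descent classes, and the 0-Hecke action on permutations *)

Section DescentClasses.
Variable n : nat.
Implicit Types (s z : 'S_n.+1) (i j : 'I_n) (p q : 'I_n.+1) (A B : {set 'I_n}).

Definition descent_class A B : {set 'S_n.+1} :=
  [set z : 'S_n.+1 | [forall j, ((j \in A) ==> (z (hi j) < z (lo j))) &&
                      ((j \notin B) ==> (z (lo j) < z (hi j)))]].

Lemma descent_classP A B z :
  reflect ((forall j, j \in A -> z (hi j) < z (lo j)) /\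
           (forall j, j \notin B -> z (lo j) < z (hi j)))
          (z \in descent_class A B).
Proof.
rewrite inE; apply: (iffP forallP) => [H|[H1 H2] j].
  by split=> j jA; have /andP[/implyP h1 /implyP h2] := H j; [apply: h1|apply: h2].
by apply/andP; split; apply/implyP; [apply: H1|apply: H2].
Qed.

(** Both inclusions of inversion sets are decided at adjacent positions, since descents, and
    likewise ascents, at adjacent positions chain up. *)
Lemma intervalLE A B : intervalL (w0 A) (w1 B) = descent_class A B.
Proof.
apply/setP => z; rewrite inE !leLE; apply/andP/descent_classP => [[]|[zA zB]].
  move=> /subsetP sA /subsetP sB; split=> j jA.
    suff /sA /inversionsP[] : (lo j, hi j) \in inversions (w0 A) by [].
    apply/inversions_w0; split=> [|k]; first exact: lo_hi.
    by rewrite lo_val hi_val ltnS -eqn_leq => /eqP/ord_inj <-.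
  case: (ltngtP (z (lo j)) (z (hi j))) => // [lt|/ord_inj/perm_inj e]; last first.
    by have := lo_hi j; rewrite e ltnn.
  have /sB /inversions_w1[_ [k]] : (lo j, hi j) \in inversions z.
    by apply/inversionsP; rewrite lo_hi.
  by rewrite lo_val hi_val ltnS -eqn_leq => /eqP/ord_inj <-; rewrite (negbTE jA).
split; apply/subsetP => -[p q].
  move=> /inversions_w0[pq H]; apply/inversionsP; split=> //.
  by apply: desR_chain pq _ => j /H; apply: zA.
move=> /inversionsP[pq lt]; apply/inversions_w1; split=> //.
case: (pickP (fun j : 'I_n => (p <= j < q) && (j \in B))) => [j /andP[]|none].
  by exists j.
have : z p < z q.
  apply: ascR_chain pq _ => j pjq; apply: zB; have := none j.
  by rewrite pjq => /negbT.
by rewrite ltnNge (ltnW lt).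
Qed.

(* pi_i acts on the basis of the regular module by [up i]. *)
Definition up i s := if desL i s then s else swap i s.

Lemma upT i s : desL i s -> up i s = s. Proof. by rewrite /up => ->. Qed.

Lemma upF i s : desL i s = false -> up i s = swap i s.
Proof. by rewrite /up => ->. Qed.

Lemma up_idem i s : up i (up i s) = up i s.
Proof. case d: (desL i s); first by rewrite !(upT d).
by rewrite (upF d) upT // desL_swap d. Qed.

Lemma up_swap i s : up i (swap i s) = up i s.
Proof. by rewrite /up desL_swap; case: (desL i s); rewrite /= ?swapK. Qed.

Lemma desL_up i s : desL i (up i s).
Proof. by rewrite /up; case: ifP => // d; rewrite desL_swap d. Qed.

Lemma inversions_up i s : inversions s \subset inversions (up i s).
Proof.
rewrite /up; case: ifPn => // d.
by have [-> _] := inversions_swap d; rewrite subsetUr.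
Qed.

Lemma simple_far i p : p != lo i -> p != hi i -> simple i p = p.
Proof. by move=> /negbTE e1 /negbTE e2; rewrite simpleE e1 e2. Qed.

Lemma desL_swap_far i j s : (i.+1 < j) || (j.+1 < i) -> desL j (swap i s) = desL j s.
Proof.
move=> ij; rewrite /desL !swapV !simple_far //;
  by rewrite ord_eqE !(lo_val, hi_val); apply/eqP; lia.
Qed.

Lemma simpleC i j : (i.+1 < j) || (j.+1 < i) ->
  (simple i * simple j = simple j * simple i)%g.
Proof.
move=> ij; rewrite conjgC {2}/simple tpermJ -/(lo i) -/(hi i) !simple_far //;
  by rewrite ord_eqE !(lo_val, hi_val); apply/eqP; lia.
Qed.

Lemma swapC i j s : (i.+1 < j) || (j.+1 < i) -> swap i (swap j s) = swap j (swap i s).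
Proof. by move=> ij; rewrite /swap /pcomp -!mulgA (simpleC ij). Qed.

Lemma up_far i j s : (i.+1 < j) || (j.+1 < i) -> up i (up j s) = up j (up i s).
Proof.
move=> ij; have ji : (j.+1 < i) || (i.+1 < j) by rewrite orbC.
rewrite /up; case dj: (desL j s); case di: (desL i s);
  by rewrite ?(desL_swap_far _ ij) ?(desL_swap_far _ ji) ?dj ?di // swapC.
Qed.

Section Adjacent.
Variables i j : 'I_n.
Hypothesis ij : j = i.+1 :> nat.

Lemma lo_adj : lo j = hi i.
Proof. by apply: ord_inj; rewrite lo_val hi_val. Qed.

Lemma simple_adj_lo : simple j (lo i) = lo i.
Proof. by apply: simple_far; rewrite ord_eqE !(lo_val, hi_val); apply/eqP; lia. Qed.

Lemma simple_adj_hi : simple i (hi j) = hi j.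
Proof. by apply: simple_far; rewrite ord_eqE !(lo_val, hi_val); apply/eqP; lia. Qed.

Lemma simple_adj_mid : simple j (hi i) = hi j.
Proof. by rewrite -lo_adj simple_lo. Qed.

Lemma swap_braid s : swap i (swap j (swap i s)) = swap j (swap i (swap j s)).
Proof.
apply/permP => p; rewrite !swapE; move: (s p) => {s}p.
have [->|nlo] := eqVneq p (lo i).
  by rewrite simple_lo simple_adj_mid simple_adj_hi simple_adj_lo simple_lo simple_adj_mid.
have [->|nhi] := eqVneq p (hi i).
  by rewrite simple_hi simple_adj_lo simple_lo simple_adj_mid simple_adj_hi -lo_adj simple_hi.
have [->|nhj] := eqVneq p (hi j).
  by rewrite simple_adj_hi simple_hi lo_adj simple_hi simple_adj_lo.
have far_i : simple i p = p by apply: simple_far.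
have far_j : simple j p = p by apply: simple_far; rewrite ?lo_adj.
by rewrite far_i far_j far_i far_j.
Qed.

Lemma desL_adj1 s : desL j (swap i s) = ((s^-1)%g (hi j) < (s^-1)%g (lo i)).
Proof. by rewrite /desL !swapV lo_adj simple_hi simple_adj_hi. Qed.

Lemma desL_adj2 s : desL i (swap j s) = ((s^-1)%g (hi j) < (s^-1)%g (lo i)).
Proof. by rewrite /desL !swapV simple_adj_lo simple_adj_mid. Qed.

Lemma desL_adj3 s : desL i (swap j (swap i s)) = desL j s.
Proof.
by rewrite /desL !swapV simple_adj_lo simple_adj_mid simple_lo simple_adj_hi lo_adj.
Qed.

Lemma desL_adj4 s : desL j (swap i (swap j s)) = desL i s.
Proof.
by rewrite /desL !swapV lo_adj simple_hi simple_adj_hi simple_adj_lo -lo_adj simple_hi.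
Qed.

Lemma up_braid s : up i (up j (up i s)) = up j (up i (up j s)).
Proof.
have di : desL i s = ((s^-1)%g (hi i) < (s^-1)%g (lo i)) by [].
have dj : desL j s = ((s^-1)%g (hi j) < (s^-1)%g (hi i)) by rewrite -lo_adj.
case ei: (desL i s); case ej: (desL j s).
- by rewrite !(upT ei, upT ej).
- rewrite (upT ei) (upF ej); have := desL_adj2 s; have := desL_adj4 s; rewrite ei => d4.
  case w: (_ < _) => d2; first by rewrite !(upT d2) upT // desL_swap ej.
  by rewrite (upF d2) upT.
- rewrite (upT ej) (upF ei); have := desL_adj1 s; have := desL_adj3 s; rewrite ej => d3.
  case w: (_ < _) => d1; first by rewrite !(upT d1) upT // desL_swap ei.
  by rewrite (upF d1) upT.
have w : ((s^-1)%g (hi j) < (s^-1)%g (lo i)) = false.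
  by move: ei ej; rewrite di dj; lia.
rewrite (upF ei) (upF ej) [up j (swap i s)]upF ?desL_adj1 //.
by rewrite [up i (swap j s)]upF ?desL_adj2 // !upF ?desL_adj3 ?desL_adj4 // swap_braid.
Qed.
End Adjacent.
End DescentClasses.

Section Linear.
Local Open Scope ring_scope.

Lemma linear_sumZ (F : fieldType) (V W : lmodType F) (f : V -> W) (J : finType)
    (a : J -> F) (v : J -> V) :
  linear f -> f (\sum_k a k *: v k) = \sum_k a k *: f (v k).
Proof.
move=> lf; pose f' := GRing.isLinear.Build F V W _ f lf.
pose g : {linear V -> W} := HB.pack f f'.
rewrite -[f]/(g : V -> W) linear_sum; apply: eq_bigr => h _.
by rewrite linearZ.
Qed.
End Linear.

(** * Modules with basis a set of permutations *)

Section Coefficients.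
Variables (F : fieldType) (n : nat) (I : {set 'S_n.+1}).
Local Open Scope ring_scope.
Implicit Types (s z g h : 'S_n.+1) (i j : 'I_n) (v w : B F I).

(** Extended by zero outside [I], so that [coef_pi] needs no case distinction on whether s_i g lies
    in [I]. *)
Definition coef v g : F := if insub g is Some x then (v : {ffun _ -> F^o}) x else 0.

Definition mkB (c : 'S_n.+1 -> F) : B F I := [ffun x => c (val x)] : B_space F I.

Lemma coef_val v (x : {g | g \in I}) : coef v (val x) = (v : {ffun _ -> F^o}) x.
Proof. by rewrite /coef valK. Qed.

Lemma coef_notin v g : g \notin I -> coef v g = 0.
Proof. by move=> gI; rewrite /coef insubN. Qed.

Lemma coef_mkB c g : coef (mkB c) g = if g \in I then c g else 0.
Proof.
case: ifPn => gI; last exact: coef_notin.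
by rewrite (_ : g = val (Sub g gI : {g | g \in I})) // coef_val ffunE.
Qed.

Lemma coef_inj v w : (forall g, g \in I -> coef v g = coef w g) -> v = w.
Proof.
move=> H; apply/ffunP => x; rewrite -!coef_val; apply: H; exact: valP.
Qed.

Lemma coef0 g : coef 0 g = 0.
Proof. by rewrite /coef; case: insub => // x; rewrite ffunE. Qed.

Lemma coefD v w g : coef (v + w) g = coef v g + coef w g.
Proof. by rewrite /coef; case: insub => [x|]; rewrite ?ffunE ?addr0. Qed.

Lemma coefZ a v g : coef (a *: v) g = a * coef v g.
Proof. by rewrite /coef; case: insub => [x|]; rewrite ?ffunE ?mulr0. Qed.

Lemma coefN v g : coef (- v) g = - coef v g.
Proof. by rewrite -scaleN1r coefZ mulN1r. Qed.

Lemma coef_sum (J : finType) (P : pred J) (f : J -> B F I) g :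
  coef (\sum_(k | P k) f k) g = \sum_(k | P k) coef (f k) g.
Proof.
apply: (big_morph (fun v => coef v g)); last exact: coef0.
by move=> v w; rewrite coefD.
Qed.

Definition eB g : B F I := B_basis F I g.

Lemma coef_eB h g : coef (eB h) g = ((g \in I) && (g == h))%:R.
Proof.
rewrite (_ : eB h = mkB (fun g => (g == h)%:R)) ?coef_mkB; first by case: ifP.
by apply/ffunP => x; rewrite !ffunE.
Qed.

Lemma eB_notin h : h \notin I -> eB h = 0.
Proof.
move=> hI; apply: coef_inj => g gI; rewrite coef_eB coef0 gI.
by case: eqP => // gh; rewrite -gh gI in hI.
Qed.

Lemma B_act_up i g : g \in I -> B_act F I i g = eB (up i g).
Proof.
move=> gI; rewrite /B_act mem_DesL; case: ifPn => d; first by rewrite (upT d).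
by rewrite (upF (negbTE d)); case: ifPn => // /eB_notin.
Qed.

Lemma eB_sum v : v = \sum_g coef v g *: eB g.
Proof.
apply: coef_inj => g gI; rewrite coef_sum (bigD1 g) //= big1 => [|h hg].
  by rewrite addr0 coefZ coef_eB gI eqxx mulr1.
by rewrite coefZ coef_eB eq_sym (negbTE hg) andbF mulr0.
Qed.

Definition linext (W : lmodType F) (b : 'S_n.+1 -> W) v := \sum_g coef v g *: b g.

Lemma linext_linear (W : lmodType F) (b : 'S_n.+1 -> W) : linear (linext b).
Proof.
move=> a v w; rewrite /linext scaler_sumr -big_split; apply: eq_bigr => g _ /=.
by rewrite coefD coefZ scalerDl scalerA.
Qed.

Lemma linext_eB (W : lmodType F) (b : 'S_n.+1 -> W) h :
  linext b (eB h) = if h \in I then b h else 0.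
Proof.
rewrite /linext (bigD1 h) //= big1 => [|g gh]; last first.
  by rewrite coef_eB (negbTE gh) andbF scale0r.
by rewrite addr0 coef_eB eqxx andbT; case: ifP; rewrite ?scale1r ?scale0r.
Qed.

Lemma eq_linext (W : lmodType F) (b b' : 'S_n.+1 -> W) v :
  (forall g, g \in I -> b g = b' g) -> linext b v = linext b' v.
Proof.
move=> bb; apply: eq_bigr => g _; case: (boolP (g \in I)) => [/bb -> //|/coef_notin ->].
by rewrite !scale0r.
Qed.

Lemma pi_linext i v : H0pi i v = linext (fun g => eB (up i g)) v.
Proof.
rewrite /= /B_pi /linext [RHS](bigID (mem I)) /= [X in _ = _ + X]big1 => [|g gI]; last first.
  by rewrite coef_notin // scale0r.
rewrite addr0 [RHS]big_sub; refine (@eq_bigr (B_space F I) 0 +%R _ _ _ _ _ _) => x _.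
by rewrite B_act_up ?coef_val //; exact: valP.
Qed.

Lemma pi_linear i : linear (@H0pi _ _ (B F I) i).
Proof. by move=> a v w; rewrite !pi_linext linext_linear. Qed.

Lemma pi_eB i g : g \in I -> H0pi i (eB g) = eB (up i g).
Proof. by move=> gI; rewrite pi_linext linext_eB gI. Qed.

(** A basis vector h contributes at g only if [up i h = g]; this forces i to be a descent of g and
    leaves h = g and h = s_i g. *)
Lemma coef_pi i v g : coef (H0pi i v) g =
  if (g \in I) && desL i g then coef v g + coef v (swap i g) else 0.
Proof.
rewrite pi_linext coef_sum.
case: (boolP (g \in I)) => gI /=; last first.
  by apply: big1 => h _; rewrite coefZ coef_eB (negbTE gI) mulr0.
case: ifP => d; last first.
  apply: big1 => h _; rewrite coefZ coef_eB gI /=; case: eqP => [gh|]; rewrite ?mulr0 //.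
  by move: d; rewrite gh desL_up.
have ne : swap i g != g.
  by apply/eqP => e; have := desL_swap i g; rewrite e d.
rewrite (bigD1 g) //= (bigD1 (swap i g)) //= big1 => [|h /andP[h1 h2]].
  by rewrite !coefZ !coef_eB up_swap gI (upT d) eqxx !mulr1 addr0.
rewrite coefZ coef_eB gI /=; case: eqP => [gh|]; rewrite ?mulr0 //.
move: gh; rewrite /up; case: ifP => _ gh; first by rewrite gh eqxx in h1.
by rewrite gh swapK eqxx in h2.
Qed.

(** Since [up] only adds inversions, convexity means that a path which has left [I] never returns.
    Products of operators on [B F I] can therefore be computed on permutations, and the relations
    are inherited from [up]. *)
Definition convexL := forall x y z, x \in I -> z \in I ->
  inversions x \subset inversions y -> inversions y \subset inversions z -> y \in I.

Lemma pi_eB_up i j g : convexL -> g \in I -> H0pi j (eB (up i g)) = eB (up j (up i g)).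
Proof.
move=> cvx gI; case: (boolP (up i g \in I)) => [|nI]; first exact: pi_eB.
rewrite !eB_notin //.
  by apply: coef_inj => h hI; rewrite coef_pi !coef0 addr0; case: ifP.
apply: contra nI => h; exact: (cvx _ _ _ gI h (inversions_up _ _) (inversions_up _ _)).
Qed.

Lemma linear_comp_linext (W W' : lmodType F) (f : W -> W') (b : 'S_n.+1 -> W) v :
  linear f -> f (linext b v) = linext (f \o b) v.
Proof. by move=> lf; rewrite /linext linear_sumZ. Qed.

Lemma B_is_H0_module : convexL -> is_H0_module (B F I).
Proof.
move=> cvx; have pi2 i j v : H0pi i (H0pi j v) = linext (fun g => eB (up i (up j g))) v.
  rewrite (pi_linext j) (linear_comp_linext _ _ (@pi_linear i)).
  by apply: eq_linext => g gI /=; apply: pi_eB_up.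
have pi3 i j k v : H0pi i (H0pi j (H0pi k v)) = linext (fun g => eB (up i (up j (up k g)))) v.
  rewrite (pi2 j k) (linear_comp_linext _ _ (@pi_linear i)).
  apply: eq_linext => g gI /=; have [jI|nI] := boolP (up j (up k g) \in I).
    exact: pi_eB.
  rewrite !eB_notin; first by apply: coef_inj => h hI; rewrite coef_pi !coef0 addr0; case: ifP.
    apply: contra nI => h; apply: cvx gI h _ (inversions_up _ _).
    exact: subset_trans (inversions_up _ _) (inversions_up _ _).
  exact: nI.
split.
- exact: pi_linear.
- by move=> i v; rewrite pi2 pi_linext; apply: eq_linext => g _; rewrite up_idem.
- by move=> i j v ij; rewrite !pi3; apply: eq_linext => g _; rewrite up_braid.
- by move=> i j v ij; rewrite !pi2; apply: eq_linext => g _; rewrite up_far.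
Qed.

Lemma B_finitely_generated : finitely_generated (B F I).
Proof.
exists [seq eB g | g <- enum 'S_n.+1] => U [U0 Ulin _] Ug v; rewrite (eB_sum v).
apply: (@big_ind _ U) => // [x y Ux Uy|g _].
  by rewrite -[x]scale1r; apply: Ulin.
rewrite -[_ *: _]addr0; apply: Ulin => //; apply: Ug.
by apply: map_f; rewrite mem_enum.
Qed.

Lemma B_fg : convexL -> is_fg_module (B F I).
Proof. by move=> cvx; split; [apply: B_is_H0_module|apply: B_finitely_generated]. Qed.

End Coefficients.

(** * Injectivity *)

Section LinearExtension.
Import boolp classical_sets.
Local Open Scope ring_scope.
Variables (F : fieldType) (V W : lmodType F) (f : V -> W).
Hypotheses (lf : linear f) (injf : injective f).

Lemma linear_0 (V' W' : lmodType F) (g : V' -> W') : linear g -> g 0 = 0.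
Proof. by move=> lg; have := lg (-1) 0 0; rewrite scaler0 addr0 scaleN1r addNr. Qed.

Lemma linear_Z (V' W' : lmodType F) (g : V' -> W') a v : linear g -> g (a *: v) = a *: g v.
Proof. by move=> lg; have := lg a v 0; rewrite addr0 (linear_0 lg) addr0. Qed.

Lemma linear_B (V' W' : lmodType F) (g : V' -> W') u v : linear g -> g (u - v) = g u - g v.
Proof. by move=> lg; have := lg (-1) v u; rewrite !scaleN1r => e; rewrite [u - v]addrC e addrC. Qed.

(** Zorn's lemma provides a complement of the image in a space of any dimension. *)
Lemma complement_ex : exists A : set W,
  [/\ forall a u v, A u -> A v -> A (a *: u + v),
      forall v, A (f v) -> v = 0 & forall w, exists v, A (w - f v)].
Proof.
(* [P] does not ask for 0 in A, so the union of the empty chain satisfies it; a maximal A is shown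
   to be nonempty afterwards. *)
pose P (A : set W) := (forall a u v, A u -> A v -> A (a *: u + v)) /\
  (forall v, A (f v) -> v = 0).
have [C CP totC|A [[Alin Af] max]] := @Zorn_bigcup W P.
  split=> [a u v [X CX Xu] [Y CY Yv]|v [X CX Xv]]; last exact: (CP X CX).2.
  have [XY|YX] := totC X Y CX CY.
    by exists Y => //; apply: (CP Y CY).1 => //; apply: XY.
  by exists X => //; apply: (CP X CX).1 => //; apply: YX.
have [u Au] : exists u, A u.
  apply: contrapT => nA; apply: (max (fun w : W => w = 0)); first split.
  - by move=> u Au; case: nA; exists u.
  - by move=> /(_ 0 erefl) A0; case: nA; exists 0.
  split=> [a u v -> ->|v]; first by rewrite scaler0 addr0.
  by move=> fv0; apply: injf; rewrite fv0 (linear_0 lf).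
have A0 : A 0 by have := Alin (-1) u u Au Au; rewrite scaleN1r addNr.
exists A; split=> // w; apply: contrapT => nw.
apply: (max (fun x => exists a y, A y /\ x = a *: w + y)).
  split=> [y Ay|sub]; first by exists 0, y; rewrite scale0r add0r.
  apply: nw; exists 0; rewrite (linear_0 lf) subr0; apply: sub.
  by exists 1, 0; rewrite scale1r addr0.
split=> [a x y [b [x' [Ax' ->]]] [c [y' [Ay' ->]]]|v [a [y [Ay e]]]].
  exists (a * b + c), (a *: x' + y'); split; first exact: Alin.
  by rewrite scalerDr scalerA scalerDl addrACA.
have [a0|a0] := eqVneq a 0; first by apply: Af; rewrite e a0 scale0r add0r.
(* From f v = a w + y with a nonzero, w - f (a^-1 v) = - a^-1 y lies in A, against the choice of
   w. *)
case: nw; exists (a^-1 *: v); rewrite (linear_Z _ _ lf) e scalerDr scalerA mulVf // scale1r.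
rewrite opprD addNKr; rewrite -[- _]addr0 -scaleNr; exact: Alin.
Qed.

Lemma extend_functional (mu : V -> F^o) : linear mu ->
  exists2 nu : W -> F^o, linear nu & forall v, nu (f v) = mu v.
Proof.
move=> lmu; have [A [Alin Af /choice[c Ac]]] := complement_ex.
have cE w v : A (w - f v) -> c w = v.
  move=> Awv; apply/eqP; rewrite -subr_eq0; apply/eqP/Af.
  rewrite (linear_B _ _ lf) (_ : _ - _ = -1 *: (w - f (c w)) + (w - f v)); first exact: Alin.
  by rewrite scaleN1r opprB addrA subrK.
exists (mu \o c) => [a u v|v] /=; last first.
  by rewrite (cE _ v) // subrr; have := Alin (-1) _ _ (Ac 0) (Ac 0); rewrite scaleN1r addNr.
rewrite -lmu; congr mu; apply: cE; rewrite lf.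
rewrite (_ : _ - _ = a *: (u - f (c u)) + (v - f (c v))); first exact: Alin.
by rewrite scalerBr opprD addrACA.
Qed.
End LinearExtension.

(** * Injectivity of the regular module *)

Section RegularModule.
Variables (F : fieldType) (n : nat).
Local Open Scope ring_scope.

Lemma desL_all (z : 'S_n.+1) : (forall i, desL i z) -> z = w0 [set: 'I_n].
Proof.
move=> dz; apply/eqP; apply: contraT => ne.
have [|i] := desL_ex ne; last by rewrite dz.
apply/subsetP => -[p q] /inversionsP[pq _]; apply/inversions_w0; split=> // j _.
by rewrite inE.
Qed.

Section Functional.
Variables (N : preH0Module F n) (nu : N -> F^o).
Hypotheses (HN : is_H0_module N) (lnu : linear nu).
Implicit Types (z : 'S_n.+1) (i j : 'I_n) (v : N).

(** If i is not a descent of z, [coef_pi] at s_i z shows that a homomorphism h satisfies coef (h v)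
    z = coef (h (pi_i v - v)) (s_i z). This is the recursion that defines [lift_coef]. *)
Definition bar i v : N := H0pi i v - v.

Lemma pi_lin i : linear (@H0pi _ _ N i). Proof. by case: HN. Qed.

Lemma bar_lin i : linear (bar i).
Proof.
move=> a u v; rewrite /bar pi_lin scalerBr opprD.
by rewrite addrACA.
Qed.

Lemma bar_pi i v : bar i (H0pi i v) = 0.
Proof. by case: HN => _ idem _ _; rewrite /bar idem subrr. Qed.

Lemma bar_far i j v : ((i.+1 < j) || (j.+1 < i))%N -> bar i (bar j v) = bar j (bar i v).
Proof.
case: HN => _ _ _ far ij.
rewrite /bar !(linear_B _ _ (@pi_lin _)) far // !opprB addrACA [RHS]addrACA.
by congr (_ + _); rewrite addrC.
Qed.

Lemma bar_braid i j v : j = i.+1 :> nat ->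
  bar i (bar j (bar i v)) = bar j (bar i (bar j v)).
Proof.
case: HN => _ idem braid _ ij.
have bB (k : 'I_n) (x y : N) : H0pi k (x - y) = H0pi k x - H0pi k y by rewrite (linear_B _ _ (@pi_lin _)).
rewrite /bar !bB !idem (braid i j) // !subrr !subr0 !opprB !addrA.
by rewrite [LHS](ACl (1*6*5*4*3*2)).
Qed.

(* [top] is fuel, large enough to reach the longest element from z; [lift_coef z]
   is the coefficient at z of the homomorphism to the regular module whose
   coefficient at the longest element is nu. *)
Let top := #|{: 'I_n.+1 * 'I_n.+1}|.

Fixpoint lift_coef_rec m z : N -> F^o :=
  if m is m'.+1 then
    if [pick i | ~~ desL i z] is Some i
    then fun v => lift_coef_rec m' (swap i z) (bar i v) else nu
  else nu.

Definition lift_coef z := lift_coef_rec (top - #|inversions z|) z.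

Lemma lift_coef_linear z : linear (lift_coef z).
Proof.
rewrite /lift_coef; move: (_ - _)%N => m; elim: m z => [|m IHm] z //=.
case: pickP => [i _|//] a u v; by rewrite bar_lin IHm.
Qed.

Lemma inversions_lt_top i z : ~~ desL i z ->
  (top - #|inversions z|)%N = (top - #|inversions (swap i z)|).+1.
Proof.
move=> d; have := max_card (mem (inversions (swap i z))).
rewrite -/top card_inversions_swap (negbTE d); lia.
Qed.

Lemma lift_coef_pick z : lift_coef z =
  if [pick i | ~~ desL i z] is Some i then fun v => lift_coef (swap i z) (bar i v) else nu.
Proof.
rewrite /lift_coef; case E: (top - #|inversions z|)%N => [|m] /=;
  case: pickP => [i d|none] //; have := inversions_lt_top d; rewrite E //.
by case=> <-.
Qed.

(** The path to the longest element does not matter: two non-descents i and k of z start two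
    ascending paths that meet again after two or three steps, and the relations between the
    operators [bar] equate the results. *)
Lemma lift_coef_swap i z v : ~~ desL i z ->
  lift_coef z v = lift_coef (swap i z) (bar i v).
Proof.
move: {2}(top - #|inversions z|)%N (erefl (top - #|inversions z|)%N) => m.
elim/ltn_ind: m i z v => m IHm i z v zm di.
have IH k l w : ~~ desL k z -> ~~ desL l (swap k z) ->
    lift_coef (swap k z) w = lift_coef (swap l (swap k z)) (bar l w).
  move=> dk dl; apply: (IHm (top - #|inversions (swap k z)|)%N) => //.
  by rewrite -zm (inversions_lt_top dk).
have IH2 k l h w : ~~ desL k z -> ~~ desL l (swap k z) -> ~~ desL h (swap l (swap k z)) ->
    lift_coef (swap l (swap k z)) w = lift_coef (swap h (swap l (swap k z))) (bar h w).
  move=> dk dl dh; apply: (IHm (top - #|inversions (swap l (swap k z))|)%N) => //.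
  by rewrite -zm (inversions_lt_top dk) (inversions_lt_top dl); lia.
(* As neither k nor l is a descent, the three values involved stand in increasing order, so that
   both three-step paths ascend. *)
have adj (k l : 'I_n) : l = k.+1 :> nat -> ~~ desL k z -> ~~ desL l z ->
    lift_coef (swap k z) (bar k v) = lift_coef (swap l z) (bar l v).
  move=> kl dk dl.
  have nw : ((z^-1)%g (hi l) < (z^-1)%g (lo k))%N = false.
    by move: dk dl; rewrite /desL (lo_adj kl); lia.
  have dlk : ~~ desL l (swap k z) by rewrite desL_adj1 // nw.
  have dkl : ~~ desL k (swap l z) by rewrite desL_adj2 // nw.
  have dklk : ~~ desL k (swap l (swap k z)) by rewrite desL_adj3.
  have dlkl : ~~ desL l (swap k (swap l z)) by rewrite desL_adj4.
  rewrite (IH _ _ _ dk dlk) (IH _ _ _ dl dkl) (IH2 _ _ _ _ dk dlk dklk) (IH2 _ _ _ _ dl dkl dlkl).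
  by rewrite swap_braid // bar_braid.
rewrite lift_coef_pick; case: pickP => [k dk|/(_ i)]; last by rewrite di.
have [far|] := boolP ((i.+1 < k) || (k.+1 < i))%N.
  have far' : ((k.+1 < i) || (i.+1 < k))%N by rewrite orbC.
  rewrite (IH k i) ?(IH i k) ?desL_swap_far //.
  by rewrite (swapC _ far) (bar_far _ far).
rewrite negb_or -!leqNgt => /andP[ki ik].
case: (ltngtP i k) => [lt|lt|/ord_inj -> //].
  by apply/esym/adj => //; lia.
by apply: adj => //; lia.
Qed.

Definition lift_hom (v : N) : B F [set: 'S_n.+1] := mkB _ (fun z => lift_coef z v).

Lemma lift_hom_is_hom : is_hom lift_hom.
Proof.
split=> [a u v|i v]; apply: coef_inj => z zI.
  by rewrite coefD coefZ !coef_mkB zI lift_coef_linear.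
rewrite coef_pi !coef_mkB !inE /=; case: ifPn => d; last first.
  by rewrite (lift_coef_swap _ d) bar_pi (linear_0 (@lift_coef_linear _)).
have d' : ~~ desL i (swap i z) by rewrite desL_swap d.
rewrite (lift_coef_swap _ d') swapK /bar (linear_B _ _ (@lift_coef_linear _)).
by rewrite addrC subrK.
Qed.
End Functional.

Lemma regular_injective : injective_module (B F [set: 'S_n.+1]).
Proof.
move=> M N f g [HM _] [HN _] [lf fpi] injf [lg gpi].
pose mu m : F^o := coef (g m) (w0 [set: 'I_n]).
have lmu : linear mu by move=> a u v; rewrite /mu lg coefD coefZ.
have [nu lnu nuf] := extend_functional lf injf lmu.
exists (lift_hom nu); first exact: lift_hom_is_hom.
move=> v; apply: coef_inj => z zI; rewrite coef_mkB zI => {zI}.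
(* Both sides agree at the longest element, as nu extends mu, and obey the same recursion from s_i z
   down to z. *)
move: {2}(#|{: 'I_n.+1 * 'I_n.+1}| - #|inversions z|)%N
  (erefl (#|{: 'I_n.+1 * 'I_n.+1}| - #|inversions z|)%N) => m.
elim/ltn_ind: m z v => m IHm z v zm.
case: (pickP (fun i => ~~ desL i z)) => [i d|none]; last first.
  rewrite lift_coef_pick; case: pickP => [i|_]; first by rewrite none.
  by rewrite nuf /mu -(desL_all (z := z)) // => i; have := none i => /negbFE.
rewrite (lift_coef_swap nu HN _ d) /bar -fpi -(linear_B _ _ lf).
rewrite (IHm _ _ _ _ (erefl _)); last by rewrite -zm (inversions_lt_top d).
rewrite (linear_B _ _ lg) gpi coefD coefN coef_pi inE /= desL_swap d swapK.
by rewrite addrC addKr.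
Qed.
End RegularModule.

(** * Young subgroups and right multiplication *)

Section Rows.
Variables (n : nat) (A B : {set 'I_n}).
Implicit Types (s z u : 'S_n.+1) (i j : 'I_n) (p q : 'I_n.+1).

(** The number, from 0, of the block that contains p when the positions are cut after each element
    of [B]; the blocks are the orbits of the Young subgroup of B^c. *)
Definition row_of p := #|[set j in B | j < p]|.

Lemma row_of_le p q : p <= q -> row_of p <= row_of q.
Proof.
move=> pq; apply: subset_leq_card; apply/subsetP => j.
by rewrite !inE => /andP[-> jp]; rewrite (leq_trans jp pq).
Qed.

Lemma row_of_lt p q : row_of p < row_of q -> p < q.
Proof. by rewrite !ltnNge; apply: contra; apply: row_of_le. Qed.

Lemma row_of_hi j : row_of (hi j) = row_of (lo j) + (j \in B).
Proof.
rewrite /row_of hi_val lo_val; case: (boolP (j \in B)) => jB.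
  rewrite (_ : [set k in B | k < j.+1] = j |: [set k in B | k < j]); last first.
    apply/setP => k; rewrite !inE ltnS leq_eqVlt -val_eqE.
    by case: eqP => [/val_inj -> |] /=; rewrite ?jB.
  by rewrite cardsU1 inE ltnn andbF addnC.
rewrite addn0; congr #|pred_of_set _|; apply/setP => k; rewrite !inE ltnS leq_eqVlt.
by case: eqP => [/ord_inj -> |] //=; rewrite (negbTE jB).
Qed.

Lemma row_of_between p q j : p <= j < q -> row_of p = row_of q -> j \notin B.
Proof.
move=> /andP[pj jq] e; apply/negP => jB.
have h1 : row_of p <= row_of (lo j) by apply: row_of_le.
have h2 : row_of (hi j) <= row_of q by apply: row_of_le; rewrite hi_val.
by move: h2; rewrite row_of_hi jB -e; lia.
Qed.

Lemma row_increasing z p q : z \in descent_class A B -> p < q ->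
  row_of p = row_of q -> z p < z q.
Proof.
move=> /descent_classP[_ zB] pq e; apply: ascR_chain pq _ => j pjq.
exact/zB/(row_of_between pjq).
Qed.

Definition young : {set 'S_n.+1} := [set u : 'S_n.+1 | [forall p, row_of (u p) == row_of p]].

Lemma youngP u : reflect (forall p, row_of (u p) = row_of p) (u \in young).
Proof. by rewrite inE; apply: (iffP forallP) => H p; apply/eqP. Qed.

Lemma youngV u : u \in young -> (u^-1)%g \in young.
Proof. by move=> /youngP yu; apply/youngP => p; rewrite -[in RHS](permKV u p) yu. Qed.

Lemma young_tperm u p q : row_of p = row_of q -> (u * tperm p q)%g \in young = (u \in young).
Proof.
move=> e; have H x : row_of (tperm p q x) = row_of x by case: tpermP => [->|->|].
by apply/youngP/youngP => yu x; have := yu x; rewrite permM H.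
Qed.

Lemma up_descent_class i z : z \in descent_class A B ->
  row_of ((z^-1)%g (lo i)) != row_of ((z^-1)%g (hi i)) -> up i z \in descent_class A B.
Proof.
move=> zI ne; rewrite /up; case: ifPn => // d.
have /descent_classP[zA zB] := zI; apply/descent_classP; split=> j jX.
  rewrite !swapE simple_lt zA //; case: ifP => [/andP[/eqP e1 /eqP e2]|_]; last by case: ifP.
  by move: d; rewrite /desL -e1 -e2 !permK lo_hi.
rewrite !swapE simple_lt zB //; case: ifP => [/andP[/eqP e1 /eqP e2]|_]; last by case: ifP.
by move: ne; rewrite -e1 -e2 !permK row_of_hi (negbTE jX) addn0 eqxx.
Qed.

Lemma same_row_up i z : z \in descent_class A B ->
  row_of ((z^-1)%g (lo i)) = row_of ((z^-1)%g (hi i)) ->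
  ~~ desL i z /\ up i z \notin descent_class A B.
Proof.
move=> zI e; have d : ~~ desL i z.
  rewrite /desL; apply/negP => lt.
  by have := row_increasing zI lt (esym e); rewrite !permKV hi_val lo_val; lia.
split=> //; rewrite (upF (negbTE d)); apply/negP => sI.
have lt : (z^-1)%g (lo i) < (z^-1)%g (hi i).
  by have := desL_swap i z; rewrite d /desL !swapV simple_lo simple_hi.
by have := row_increasing sI lt e; rewrite !swapE !permKV simple_lo simple_hi lo_val hi_val; lia.
Qed.

Lemma young_inversions u : u \in young -> u != 1%g ->
  exists p q, [/\ p < q, row_of p = row_of q & u q < u p].
Proof.
move=> /youngP yu u1.
case: (pickP (fun pq : 'I_n.+1 * 'I_n.+1 =>
   [&& pq.1 < pq.2, row_of pq.1 == row_of pq.2 & u pq.2 < u pq.1])) => [[p q]|none].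
  by case/and3P => ? /eqP ? ?; exists p, q.
have [|i _] := desL_ex u1; last by rewrite inversions1 inE.
apply/subsetP => -[p q] /inversionsP[pq lt]; have := none (p, q); rewrite /= pq lt andbT /=.
have := row_of_le (ltnW pq); rewrite leq_eqVlt => /orP[->//|].
by rewrite -(yu p) -(yu q) => /row_of_lt /ltnW; rewrite leqNgt lt.
Qed.

(** As z increases on each block, its inversions join different blocks, and the inverse of u carries
    them to inversions of the product. The pair inverted by u inside a block is one more. *)
Lemma young_length z u : z \in descent_class A B -> u \in young -> u != 1%g ->
  #|inversions z| < #|inversions (u * z)%g|.
Proof.
move=> zI yu u1; have [p [q [pq e lt]]] := young_inversions yu u1.
have yV := youngP _ (youngV yu).
pose f (x : 'I_n.+1 * 'I_n.+1) := ((u^-1)%g x.1, (u^-1)%g x.2).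
have injf : injective f by case=> ? ? [? ?] [] /perm_inj /= -> /perm_inj /= ->.
have rowlt x y : (x, y) \in inversions z -> row_of x < row_of y.
  move=> /inversionsP[xy zyx]; rewrite ltn_neqAle row_of_le ?(ltnW xy) // andbT.
  by apply/eqP => exy; have := row_increasing zI xy exy; rewrite ltnNge (ltnW zyx).
rewrite -(card_imset _ injf); apply: proper_card; apply/properP; split.
  apply/subsetP => y /imsetP[[x x'] xx' ->{y}]; apply/inversionsP; rewrite /= !permM !permKV.
  have /inversionsP[_ ->] := xx'; split=> //; apply: row_of_lt.
  by rewrite !yV rowlt.
exists (p, q).
  apply/inversionsP; rewrite !permM; split=> //.
  by apply: row_increasing zI lt _; rewrite !(youngP _ yu).
apply/negP => /imsetP[[x x'] /rowlt xx' [ex ex']].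
by move: e xx'; rewrite ex ex' !yV => ->; rewrite ltnn.
Qed.

(* Right multiplication by pi_j on the basis of the regular module *)
Definition upR j s : 'S_n.+1 := if s (hi j) < s (lo j) then s else (simple j * s)%g.

(** The two multiplications interact only if s maps {j, j+1} onto {i, i+1}; in that case exchanging
    the two positions and exchanging the two values give the same permutation. *)
Lemma upR_up i j s : up i (upR j s) = upR j (up i s).
Proof.
have [/andP[/eqP slo /eqP shi]|ne1] := boolP ((s (lo j) == lo i) && (s (hi j) == hi i)).
  have sw : (simple j * s)%g = swap i s.
    apply/permP => x; rewrite permM swapE !simpleE -slo -shi !(inj_eq perm_inj).
    by case: eqP => // _; case: eqP.
  have d : desL i s = false by rewrite /desL -slo -shi !permK lo_val hi_val; lia.
  rewrite /upR slo shi ltnNge ltnW ?lo_hi //= sw up_swap (upF d).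
  by rewrite !swapE slo shi simple_lo simple_hi lo_hi.
have [/andP[/eqP slo /eqP shi]|ne2] := boolP ((s (lo j) == hi i) && (s (hi j) == lo i)).
  have d : desL i s by rewrite /desL -slo -shi !permK lo_hi.
  by rewrite /upR slo shi lo_hi (upT d) slo shi lo_hi.
have VP p q : ((s^-1)%g q == p) = (s p == q) by rewrite [RHS]eq_permV eq_sym.
have dL : desL i (simple j * s)%g = desL i s.
  rewrite /desL invMg !permM simpleV simple_lt !VP (negbTE ne2).
  by rewrite [(s (hi j) == hi i) && _]andbC (negbTE ne1).
have dR : (swap i s (hi j) < swap i s (lo j)) = (s (hi j) < s (lo j)).
  rewrite !swapE simple_lt [(s (hi j) == lo i) && _]andbC (negbTE ne2).
  by rewrite [(s (hi j) == hi i) && _]andbC (negbTE ne1).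
have comm : swap i (simple j * s)%g = (simple j * swap i s)%g by rewrite /swap /pcomp mulgA.
by rewrite /upR /up; case d: (desL i s); case e: (s (hi j) < s (lo j));
  rewrite /= ?dR ?e ?dL ?d ?comm.
Qed.

Lemma upRE j s : upR j s = ((up j (s^-1))^-1)%g.
Proof.
rewrite /upR /up /desL invgK; case: ifP => _; first by rewrite invgK.
by rewrite /swap /pcomp invMg simpleV invgK.
Qed.

Lemma upR_length j s : #|inversions s| <= #|inversions (upR j s)| ?= iff (s (hi j) < s (lo j)).
Proof.
have <- : desL j (s^-1)%g = (s (hi j) < s (lo j)) by rewrite /desL invgK.
rewrite upRE card_inversionsV -(card_inversionsV s) /up.
case: ifPn => d; first by split=> //; rewrite eqxx.
rewrite card_inversions_swap (negbTE d); split; first by lia.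
by apply/negbTE; lia.
Qed.

Definition upR_seq (l : seq 'I_n) s := foldr upR s l.

Lemma upR_seq_length l s : #|inversions s| <= #|inversions (upR_seq l s)|.
Proof. by elim: l => //= j l IHl; apply: leq_trans IHl _; apply: upR_length. Qed.

Lemma upR_seq_fix l s : (forall j, j \in l -> s (hi j) < s (lo j)) -> upR_seq l s = s.
Proof.
elim: l => //= x l IHl H; rewrite IHl => [|y yl]; last by apply: H; rewrite inE yl orbT.
by rewrite /upR H ?mem_head.
Qed.

Lemma upR_seq_stable l s : #|inversions (upR_seq l s)| <= #|inversions s| ->
  forall j, j \in l -> s (hi j) < s (lo j).
Proof.
elim: l => //= j l IHl le k; have h1 := upR_seq_length l s.
have h2 := upR_length j (upR_seq l s).
have e : #|inversions (upR_seq l s)| = #|inversions s|.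
  by apply/eqP; rewrite eqn_leq h1 andbT; apply: leq_trans h2 le.
have fixl x : x \in l -> s (hi x) < s (lo x) by apply: IHl; rewrite e.
have sE : upR_seq l s = s by apply: upR_seq_fix.
rewrite inE => /orP[/eqP ->|/fixl //]; have [_] := h2; rewrite sE => <-.
by rewrite eqn_leq; move: le (leq_of_leqif h2); rewrite sE => -> ->.
Qed.

(* Right multiplication by pi_{w_0(A)}: the iterates of the product of the pi_j,
   j in A, are stationary. *)
Definition upA s := iter #|{: 'I_n.+1 * 'I_n.+1}|.+1 (upR_seq (enum A)) s.

Lemma upA_up i s : upA (up i s) = up i (upA s).
Proof.
rewrite /upA; elim: (#|{: 'I_n.+1 * 'I_n.+1}|.+1) => //= m ->; move: (iter _ _ _) => {}s.
by elim: (enum A) => //= j l ->; rewrite -upR_up.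
Qed.

Lemma upA_length s : #|inversions s| <= #|inversions (upA s)|.
Proof.
rewrite /upA; elim: (#|{: 'I_n.+1 * 'I_n.+1}|.+1) => //= m IHm; apply: leq_trans IHm _; exact: upR_seq_length.
Qed.

Lemma upA_fix s : (forall j, j \in A -> s (hi j) < s (lo j)) -> upA s = s.
Proof.
move=> sA; rewrite /upA; elim: (#|{: 'I_n.+1 * 'I_n.+1}|.+1) => //= m ->.
by apply: upR_seq_fix => j; rewrite mem_enum; apply: sA.
Qed.

Lemma upA_desR s j : j \in A -> upA s (hi j) < upA s (lo j).
Proof.
(* Each round either finds all of [A] among the right descents or gains an inversion; the number of
   rounds exceeds the number of pairs. *)
move=> jA; have H m : (forall k, k \in A -> iter m (upR_seq (enum A)) s (hi k) <
     iter m (upR_seq (enum A)) s (lo k)) \/ m <= #|inversions (iter m (upR_seq (enum A)) s)|.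
  elim: m => [|m IHm]; first by right.
  set z := iter m _ s in IHm *; have [le|lt] := leqP #|inversions (iter m.+1 (upR_seq (enum A)) s)| #|inversions z|.
    have zA := upR_seq_stable le; left; rewrite iterS -/z (upR_seq_fix zA) => k kA.
    by apply: zA; rewrite mem_enum.
  case: IHm => [zA|le]; last by right; apply: leq_ltn_trans le lt.
  move: lt; rewrite iterS -/z upR_seq_fix ?ltnn // => k.
  by rewrite mem_enum; apply: zA.
have [zA|] := H #|{: 'I_n.+1 * 'I_n.+1}|.+1; first exact: zA.
by rewrite ltnNge max_card.
Qed.
End Rows.

Section Homs.
Variables (F : fieldType) (n : nat).
Local Open Scope ring_scope.
Implicit Types M N E : preH0Module F n.

Lemma hom_comp M N E (f : M -> N) (g : N -> E) : is_hom f -> is_hom g -> is_hom (g \o f).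
Proof.
move=> [lf pf] [lg pg]; split=> [a u v|i v] /=; first by rewrite lf lg.
by rewrite pf pg.
Qed.

Lemma hom_linext (I : {set 'S_n.+1}) M (b : 'S_n.+1 -> M) :
  is_H0_module M ->
  (forall i g, g \in I -> H0pi i (b g) = if up i g \in I then b (up i g) else 0) ->
  is_hom (linext b : B F I -> M).
Proof.
move=> HM H; have [lp _ _ _] := HM; split=> [|i v]; first exact: linext_linear.
rewrite (linear_comp_linext _ _ (lp i)) pi_linext (linear_comp_linext _ _ (@linext_linear _ _ _ _ _)).
by apply: eq_linext => g gI /=; rewrite linext_eB H.
Qed.

(* If h - id strictly increases the number of inversions, it is nilpotent and h
   has the inverse [\sum_k (id - h)^k]. *)
Lemma unipotent_hom (I : {set 'S_n.+1}) (h : B F I -> B F I) : is_H0_module (B F I) ->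
  is_hom h ->
  (forall z, z \in I -> exists2 b : 'S_n.+1 -> F, h (eB F I z) = eB F I z + \sum_g b g *: eB F I g
     & forall g, (#|inversions g| <= #|inversions z|)%N -> b g = 0) ->
  exists2 k : B F I -> B F I, is_hom k & forall v, k (h v) = v.
Proof.
move=> HI [lh ph] tri; have [lp _ _ _] := HI.
pose N v : B F I := v - h v.
have lN : linear N by move=> a u v; rewrite /N lh scalerBr opprD addrACA.
have pN i v : N (H0pi i v) = H0pi i (N v) by rewrite /N ph (linear_B _ _ (lp i)).
have lNk m : linear (iter m N).
  by elim: m => [|m IHm] a u v //=; rewrite IHm lN.
have pNk m i v : iter m N (H0pi i v) = H0pi i (iter m N v).
  by elim: m => [|m IHm] //=; rewrite IHm pN.
(* [N] raises the length below which all coefficients vanish, so its power beyond the maximal length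
   is zero. *)
pose low m (v : B F I) := forall g, (#|inversions g| < m)%N -> coef v g = 0.
have lowN m v : low m v -> low m.+1 (N v).
  move=> lv g gm; rewrite (eB_sum v) (linear_sumZ _ _ lN) coef_sum; apply: big1 => z _.
  have [zI|/coef_notin ->] := boolP (z \in I); last by rewrite scale0r coef0.
  have [zm|mz] := ltnP #|inversions z| m; first by rewrite (lv z zm) scale0r coef0.
  have [b hb b0] := tri z zI.
  rewrite coefZ /N hb opprD addNKr coefN coef_sum big1 ?oppr0 ?mulr0 // => x _.
  rewrite coefZ coef_eB; case: eqP => [gx|]; rewrite ?andbF ?mulr0 // -gx b0 ?mul0r //.
  by apply: leq_trans mz; rewrite -ltnS.
have lowk m v : low m (iter m N v).
  by elim: m => [|m IHm]; [move=> g; rewrite ltn0|apply: lowN].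
pose K := #|{: 'I_n.+1 * 'I_n.+1}|.+1.
have NK v : iter K N v = 0.
  by apply: coef_inj => g _; rewrite coef0; apply: lowk; rewrite ltnS max_card.
exists (fun v => \sum_(k < K) iter k N v) => [|v]; first split=> [a u v|i v].
- by rewrite scaler_sumr -big_split; apply: eq_bigr => k _; rewrite lNk.
- have := linear_sumZ (fun _ => 1) (fun k : 'I_K => iter k N v) (lp i).
  under eq_bigr do rewrite scale1r; move=> ->; apply: eq_bigr => k _.
  by rewrite scale1r pNk.
have tel m : \sum_(k < m) iter k N (h v) = v - iter m N v.
  elim: m => [|m IHm]; first by rewrite big_ord0 subrr.
  have e : iter m N (h v) = iter m N v - iter m.+1 N v.
    by rewrite iterSr {3}/N (linear_B _ _ (lNk m)) opprB addrC subrK.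
  by rewrite big_ord_recr /= IHm e addrA subrK.
by rewrite tel NK subr0.
Qed.
End Homs.

(** * Descent class modules as retracts of the regular module *)

Section DescentClassInjective.
Variables (F : fieldType) (n : nat) (A B : {set 'I_n}).
Local Open Scope ring_scope.
Local Notation I := (descent_class A B).
Implicit Types (s z u g : 'S_n.+1) (i j : 'I_n).

Lemma descent_class_convex : convexL I.
Proof.
move=> x y z; rewrite -!intervalLE !inE !leLE => /andP[xA _] /andP[_ zB] xy yz.
by rewrite (subset_trans xA xy) (subset_trans yz zB).
Qed.

Lemma setT_convex : convexL [set: 'S_n.+1]. Proof. by move=> *; rewrite inE. Qed.

(* Up to sign, [antisym z] is the product of z and of the element
   (pi_{j_1} - 1) .. (pi_{j_k} - 1), where s_{j_1} .. s_{j_k} is a reduced word of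
   w_0(B^c). *)
Definition young_sign u : F := if u \in young B then (-1) ^+ u else 0.

Definition antisym z : Defs.B F [set: 'S_n.+1] := \sum_u young_sign u *: eB F _ (u * z)%g.

Lemma pi_antisym i z : z \in I ->
  H0pi i (antisym z) = if up i z \in I then antisym (up i z) else 0.
Proof.
move=> zI; rewrite /antisym (linear_sumZ _ _ (@pi_linear _ _ _ i)).
under eq_bigr do rewrite pi_eB ?inE //.
set a := (z^-1)%g (lo i); set b := (z^-1)%g (hi i).
have dL u : desL i (u * z)%g = ((u^-1)%g b < (u^-1)%g a)%N by rewrite /desL invMg !permM.
have [e|ne] := eqVneq (row_of B a) (row_of B b); last first.
  rewrite up_descent_class //; apply: eq_bigr => u _; rewrite /young_sign.
  case: ifP => [uy|]; last by rewrite !scale0r.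
  have uV := youngP _ _ (youngV uy).
  suff d : desL i (u * z)%g = desL i z.
    by rewrite /up d; case: ifP => // _; rewrite /swap /pcomp mulgA.
  rewrite dL /desL -/a -/b; move: ne; rewrite neq_ltn => /orP[] lt.
    have lt1 : ((u^-1)%g a < (u^-1)%g b)%N by apply: (@row_of_lt _ B); rewrite !uV.
    by have lt2 := row_of_lt lt; lia.
  have lt1 : ((u^-1)%g b < (u^-1)%g a)%N by apply: (@row_of_lt _ B); rewrite !uV.
  by have lt2 := row_of_lt lt; rewrite lt1 lt2.
have [d /negbTE ->] := same_row_up zI e.
have ab : a != b by rewrite /a /b (inj_eq perm_inj) ord_eqE lo_val hi_val; apply/eqP; lia.
(* The positions a and b of i and i+1 share a block, so u -> u t is a sign-reversing pairing of the
   Young subgroup. The two products differ by s_i on the left and have the same image under [up i]: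
   the terms cancel. *)
pose t := tperm a b.
have uz u : (u * t * z)%g = swap i (u * z)%g.
  rewrite /swap /pcomp -!mulgA; congr (_ * _)%g; rewrite [(z * _)%g]conjgCV.
  by congr (_ * _)%g; rewrite /simple tpermJ.
rewrite (bigID (fun u => desL i (u * z)%g)) /= addrC (reindex_inj (mulIg t)) /=.
rewrite [X in X + _](eq_bigl (fun u => desL i (u * z)%g)) => [|u]; last first.
  by rewrite uz desL_swap negbK.
rewrite -big_split big1 //= => u _; rewrite uz up_swap -scalerDl.
rewrite /young_sign young_tperm //; case: ifP => _; last by rewrite addr0 scale0r.
by rewrite odd_permM odd_tperm ab addbT signrN addNr scale0r.
Qed.

Definition class_incl : Defs.B F I -> Defs.B F [set: 'S_n.+1] := linext antisym.
Definition class_proj : Defs.B F [set: 'S_n.+1] -> Defs.B F I := linext (fun z => eB F I (upA A z)).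

Lemma class_incl_hom : is_hom class_incl.
Proof.
apply: hom_linext => [|i g gI]; first exact/B_is_H0_module/setT_convex.
exact: pi_antisym.
Qed.

Lemma class_proj_hom : is_hom class_proj.
Proof.
have HI := B_is_H0_module F descent_class_convex.
apply: hom_linext => // i g _; rewrite inE upA_up.
have [gI|nI] := boolP (upA A g \in I); first exact: pi_eB.
rewrite !eB_notin //; first by case: HI => lp _ _ _; rewrite (linear_0 (lp i)).
(* The descents in [A] are secured by [upA], so being outside the class means a descent outside [B],
   and [up i] keeps this inversion. *)
apply: contra nI => /descent_classP[_ zB]; apply/descent_classP; split=> [j|j jB].
  exact: upA_desR.
rewrite ltnNge; apply/negP => le; have lt : (upA A g (hi j) < upA A g (lo j))%N.
  rewrite ltn_neqAle le andbT -ord_eqE (inj_eq perm_inj) ord_eqE lo_val hi_val.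
  by apply/eqP; lia.
have /(subsetP (inversions_up i _)) /inversionsP[_] : (lo j, hi j) \in inversions (upA A g).
  by apply/inversionsP; rewrite lo_hi.
by rewrite ltnNge ltnW // zB.
Qed.

(** The term u = 1 returns z, which [upA] fixes; any other u of the Young subgroup lengthens z, and
    [upA] never shortens. *)
Lemma class_proj_incl z : z \in I ->
  exists2 b : 'S_n.+1 -> F,
    class_proj (class_incl (eB F I z)) = eB F I z + \sum_g b g *: eB F I g
  & forall g, (#|inversions g| <= #|inversions z|)%N -> b g = 0.
Proof.
move=> zI; pose Z u := upA A (u * z)%g.
exists (fun g => \sum_(u | (u != 1%g) && (Z u == g)) young_sign u) => [|g gz].
  rewrite /class_incl linext_eB zI /antisym /class_proj.
  rewrite (linear_sumZ _ _ (@linext_linear _ _ _ _ _)) (bigD1 1%g) //=.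
  rewrite linext_eB inE mul1g upA_fix; last by case/descent_classP: zI.
  rewrite {1}/young_sign; have -> : 1%g \in young B by apply/youngP => p; rewrite perm1.
  rewrite odd_perm1 expr0 scale1r; congr (_ + _).
  rewrite (partition_big Z xpredT) //=; apply: eq_bigr => g _.
  rewrite scaler_suml; apply: eq_bigr => u /andP[_ /eqP <-].
  by rewrite linext_eB inE.
apply: big1 => u /andP[u1 /eqP ug]; rewrite /young_sign; case: ifP => // uy.
have := young_length zI uy u1; have := upA_length A (u * z)%g; rewrite -/(Z u) ug.
by move=> h1 h2; have := leq_trans h2 (leq_trans h1 gz); rewrite ltnn.
Qed.

Lemma descent_class_injective : injective_module (Defs.B F I).
Proof.
move=> M N f g fgM fgN hf injf hg.
have HI := B_is_H0_module F descent_class_convex.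
have hpi := hom_comp class_incl_hom class_proj_hom.
have [k hk kE] := unipotent_hom HI hpi class_proj_incl.
have [h hh hE] := regular_injective fgM fgN hf injf (hom_comp hg class_incl_hom).
exists (k \o (class_proj \o h)).
  exact: hom_comp (hom_comp hh class_proj_hom) hk.
by move=> v /=; rewrite hE /=; apply: (kE (g v)).
Qed.
End DescentClassInjective.

(** * Essentiality *)

Section Eigenvector.
Variables (F : fieldType) (n : nat) (I : {set 'S_n.+1}).
Local Open Scope ring_scope.
Implicit Types (g z : 'S_n.+1) (i j : 'I_n) (u v : Defs.B F I).

(* Among the nonzero vectors of U, one whose support has the longest possible
   shortest elements, and the fewest of them, is a common eigenvector: these
   elements are split by the generator pi_i into those that have i as a descent
   and those that have not. *)
Lemma common_eigenvector (U : Defs.B F I -> Prop) u : is_submodule U -> U u -> u != 0 ->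
  exists w, [/\ U w, w != 0 & forall i, H0pi i w = w \/ H0pi i w = 0].
Proof.
move=> [_ Ulin Upi] Uu u0.
pose T := #|{: 'S_n.+1}|; pose K := #|{: 'I_n.+1 * 'I_n.+1}|.
have lenK g : (#|inversions g| <= K)%N by apply: max_card.
pose lead v m := [set g | (coef v g != 0) && (#|inversions g| == m)].
have minsupp v : v != 0 -> exists2 g, coef v g != 0 &
    forall h, coef v h != 0 -> (#|inversions g| <= #|inversions h|)%N.
  move=> v0; case: (pickP (fun g => coef v g != 0)) => [g vg|none].
    by case: (@arg_minnP _ g (fun g => coef v g != 0) (fun g => #|inversions g|) vg) => h vh hmin; exists h.
  case/eqP: v0; apply: coef_inj => g _; rewrite coef0; apply/eqP.
  by have := none g => /negbFE.
(* There are at most [T] leading elements, so the weight [T.+1] makes this sum encode the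
   lexicographic order on the two quantities. *)
have main M : forall v g, U v -> coef v g != 0 ->
    (forall h, coef v h != 0 -> (#|inversions g| <= #|inversions h|)%N) ->
    ((K - #|inversions g|) * T.+1 + #|lead v #|inversions g| | < M)%N ->
    exists w, [/\ U w, w != 0 & forall i, H0pi i w = w \/ H0pi i w = 0].
  elim: M => // M IHM v g Uv vg ming lt.
  set m := #|inversions g| in ming lt.
  have next w : U w -> w != 0 -> (forall h, (#|inversions h| < m)%N -> coef w h = 0) ->
      (#|lead w m| < #|lead v m|)%N ->
      exists w, [/\ U w, w != 0 & forall i, H0pi i w = w \/ H0pi i w = 0].
    move=> Uw w0 low ltl; have [h wh minh] := minsupp w w0.
    apply: (IHM w h) => //.
    have mh : (m <= #|inversions h|)%N.
      by rewrite leqNgt; apply: contra wh => /low ->.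
    move: mh; rewrite leq_eqVlt => /orP[/eqP <-|mh]; first by lia.
    have l1 : (#|lead w #|inversions h| | <= T)%N by apply: max_card.
    have l2 := lenK h.
    have : ((K - #|inversions h|).+1 * T.+1 <= (K - m) * T.+1)%N by rewrite leq_pmul2r //; lia.
    by rewrite mulSn; lia.
  have lowv h : (#|inversions h| < m)%N -> coef v h = 0.
    by move=> hm; apply/eqP; apply: contraTT hm => /ming; rewrite -leqNgt.
  (* Elements shorter than m have coefficient zero, so on the leading ones pi_i keeps those with
     descent i and kills the others. *)
  have coefpi i h : (#|inversions h| <= m)%N ->
      coef (H0pi i v) h = if desL i h then coef v h else 0.
    move=> hm; rewrite coef_pi; case: (boolP (h \in I)) => /= [hI|/coef_notin ->]; last by case: ifP.
    case: ifP => //= d; rewrite [X in _ + X]lowv ?addr0 // card_inversions_swap d.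
    by have := card_inversions_desL d; lia.
  have [/forallP eig|] := boolP [forall i, (H0pi i v == v) || (H0pi i v == 0)].
    exists v; split=> //; first by apply: contraNneq vg => ->; rewrite coef0.
    by move=> i; have /orP[/eqP|/eqP] := eig i; [left|right].
  rewrite negb_forall => /existsP[k]; rewrite negb_or => /andP[n1 n0].
  have [dg|ndg] := boolP (desL k g).
    apply: (next (v - H0pi k v)).
    - by rewrite addrC -scaleN1r; apply: Ulin => //; apply: Upi.
    - by rewrite subr_eq0 eq_sym.
    - move=> h hm; rewrite coefD coefN coefpi 1?ltnW // lowv //.
      by case: ifP; rewrite subrr.
    apply: proper_card; apply/properP; split.
      apply/subsetP => h; rewrite !inE => /andP[+ /eqP hm]; rewrite hm eqxx andbT.
      rewrite coefD coefN coefpi ?hm //; case: ifP => _; rewrite ?subr0 //.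
      by rewrite subrr eqxx.
    exists g; first by rewrite inE vg eqxx.
    by rewrite inE coefD coefN coefpi // dg subrr eqxx.
  apply: (next (H0pi k v)) => //; first exact: Upi.
  - by move=> h hm; rewrite coefpi 1?ltnW // lowv //; case: ifP.
  apply: proper_card; apply/properP; split.
    apply/subsetP => h; rewrite !inE => /andP[+ /eqP hm]; rewrite hm eqxx andbT.
    by rewrite coefpi ?hm //; case: ifP; rewrite ?eqxx.
  exists g; first by rewrite inE vg eqxx.
  by rewrite inE coefpi // (negbTE ndg) eqxx.
have [g ug ming] := minsupp u u0.
exact: (main _ u g Uu ug ming (ltnSn _)).
Qed.
End Eigenvector.

(** * Supports of common eigenvectors *)

Section Socle.
Variables (F : fieldType) (n : nat) (A B : {set 'I_n}).

Local Notation I := (descent_class A B).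
Implicit Types (z : 'S_n.+1) (i j d : 'I_n) (p q x y : 'I_n.+1).
Local Open Scope ring_scope.
Variable u : Defs.B F I.
Hypothesis eig : forall i, H0pi i u = u \/ H0pi i u = 0.
Local Close Scope ring_scope.

Let supp z := (coef u z != 0)%R.
Let J i := (H0pi i u == u).

Lemma supp_in z : supp z -> z \in I.
Proof. by apply: contraR => /coef_notin; rewrite /supp => ->; rewrite eqxx. Qed.

Lemma supp_desL i z : supp z -> J i -> desL i z.
Proof.
rewrite /supp /J => sz /eqP e; move: sz; rewrite -e coef_pi.
by case: ifP => [/andP[]|]; rewrite ?eqxx.
Qed.

(** When pi_i u = 0, the coefficients at z and s_i z add up to zero as soon as the longer of the two
    lies in the class. *)
Lemma supp_swap i z : supp z -> ~~ J i ->
  desL i z || (swap i z \in I) -> supp (swap i z).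
Proof.
move=> sz; have zI := supp_in sz; move: sz; rewrite /supp /J => sz nJ h.
have e : (H0pi i u = 0)%R by case: (eig i) => // e; rewrite e eqxx in nJ.
have c g : g \in I -> desL i g -> (coef u g + coef u (swap i g) = 0)%R.
  by move=> gI dg; have := coef_pi i u g; rewrite e coef0 gI dg.
case: (boolP (desL i z)) h => /= [d _|d sI].
  by apply: contra sz => /eqP s0; have := c _ zI d; rewrite s0 addr0 => ->.
have d' : desL i (swap i z) by rewrite desL_swap d.
apply: contra sz => /eqP s0; have := c _ sI d'; rewrite s0 add0r swapK => ->.
exact: eqxx.
Qed.

Lemma supp_swap_row i z : supp z -> ~~ J i ->
  row_of B ((z^-1)%g (lo i)) != row_of B ((z^-1)%g (hi i)) -> supp (swap i z).
Proof.
move=> sz nJ ne; apply: supp_swap => //; case: (boolP (desL i z)) => //= d.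
by have := up_descent_class (supp_in sz) ne; rewrite (upF (negbTE d)).
Qed.

Lemma ord_lo x y : x < y -> exists i, [/\ x = lo i, hi i <= y & x = i :> nat].
Proof.
move=> xy; have xn : x < n by have := ltn_ord y; lia.
by exists (Ordinal xn); split=> //; apply: ord_inj.
Qed.

Lemma ord_hi x y : x < y -> exists i, [/\ y = hi i, x <= lo i & y = i.+1 :> nat].
Proof.
case: y => -[//|y] yn xy; have yn' : y < n by [].
by exists (Ordinal yn'); split=> //; apply: ord_inj; rewrite hi_val.
Qed.

(** Consecutive values in different rows can be exchanged within the support; when they share a row,
    no exchange is made and the row is simply passed on to the next value. *)
Lemma move_up z x y : supp z -> x <= y -> (forall i, x <= i < y -> ~~ J i) ->
  exists z', [/\ supp z', row_of B ((z'^-1)%g y) = row_of B ((z^-1)%g x) &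
    forall v : 'I_n.+1, y < v -> (z'^-1)%g v = (z^-1)%g v].
Proof.
move: {2}(y - x) (erefl (y - x)) => m; elim: m z x => [|m IHm] z x yx sz xy nJ.
  have <- : x = y by apply: ord_inj; lia.
  by exists z.
have [|i [xi iy xin]] := @ord_lo x y; first by lia.
have nJi : ~~ J i by apply: nJ; rewrite hi_val in iy; lia.
have nJ' j : hi i <= j < y -> ~~ J j by rewrite hi_val => h; apply: nJ; lia.
have yi : y - hi i = m by rewrite hi_val; lia.
have [e|ne] := eqVneq (row_of B ((z^-1)%g (lo i))) (row_of B ((z^-1)%g (hi i))).
  have [z' [? ? ?]] := IHm z (hi i) yi sz iy nJ'.
  by exists z'; split=> //; rewrite xi e.
have [z' [sz' rz' fz']] := IHm _ (hi i) yi (supp_swap_row sz nJi ne) iy nJ'.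
exists z'; split=> // [|v yv]; first by rewrite rz' swapV simple_hi xi.
rewrite fz' // swapV simple_far //; rewrite ord_eqE ?lo_val ?hi_val; apply/eqP;
  move: iy; rewrite hi_val; lia.
Qed.

Lemma move_down z x y : supp z -> x <= y -> (forall i, x <= i < y -> ~~ J i) ->
  exists z', [/\ supp z', row_of B ((z'^-1)%g x) = row_of B ((z^-1)%g y) &
    forall v : 'I_n.+1, v < x -> (z'^-1)%g v = (z^-1)%g v].
Proof.
move: {2}(y - x) (erefl (y - x)) => m; elim: m z y => [|m IHm] z y yx sz xy nJ.
  have <- : x = y by apply: ord_inj; lia.
  by exists z.
have [|i [yi xi yin]] := @ord_hi x y; first by lia.
have nJi : ~~ J i by apply: nJ; move: xi; rewrite lo_val; lia.
have nJ' j : x <= j < lo i -> ~~ J j by rewrite lo_val => h; apply: nJ; lia.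
have xim : lo i - x = m by rewrite lo_val; lia.
have [e|ne] := eqVneq (row_of B ((z^-1)%g (lo i))) (row_of B ((z^-1)%g (hi i))).
  have [z' [? ? ?]] := IHm z (lo i) xim sz xi nJ'.
  by exists z'; split=> //; rewrite yi -e.
have [z' [sz' rz' fz']] := IHm _ (lo i) xim (supp_swap_row sz nJi ne) xi nJ'.
exists z'; split=> // [|v vx]; first by rewrite rz' swapV simple_lo yi.
rewrite fz' // swapV simple_far //; rewrite ord_eqE ?lo_val ?hi_val; apply/eqP;
  move: xi; rewrite lo_val; lia.
Qed.

(** Once the two rows have been transported to the values i and i+1, the descent i puts i+1 before
    i, and an increasing row cannot hold both. *)
Lemma row_boundary z i x y : supp z -> J i -> x <= lo i -> hi i <= y ->
  (forall j, x <= j < lo i -> ~~ J j) -> (forall j, hi i <= j < y -> ~~ J j) ->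
  row_of B ((z^-1)%g y) < row_of B ((z^-1)%g x).
Proof.
move=> sz Ji xi iy nJ1 nJ2.
have [z1 [sz1 r1 f1]] := move_up sz xi nJ1.
have [z2 [sz2 r2 f2]] := move_down sz1 iy nJ2.
have yi : lo i < y by move: iy; rewrite hi_val lo_val.
rewrite -(f1 y yi) -r1 -r2 -(f2 _ (lo_hi i)).
have d := supp_desL sz2 Ji; rewrite ltn_neqAle row_of_le ?(ltnW d) // andbT.
apply/eqP => e; have := row_increasing (supp_in sz2) d e.
by rewrite !permKV hi_val lo_val; lia.
Qed.

Lemma row_separated z i x y : supp z -> J i -> x <= i < y ->
  row_of B ((z^-1)%g y) < row_of B ((z^-1)%g x).
Proof.
move: {2}(y - x) (erefl (y - x)) => m; elim/ltn_ind: m i x => m IHm i x yx sz Ji xiy.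
pose P i := J i && (x <= i < y).
have Pi : P i by rewrite /P Ji xiy.
(* [k] is the least element of [J] in [x, y), so [row_boundary] applies from x across [k]; induction
   covers the way from k+1 to y. *)
case: (@arg_minnP _ i P (fun i : 'I_n => i : nat) Pi) => k /andP[Jk /andP[xk ky]] kmin.
have nJ1 j : x <= j < lo k -> ~~ J j.
  rewrite lo_val => /andP[xj jk]; apply/negP => Jj.
  by have := kmin j; rewrite /P Jj xj (ltn_trans jk ky) => /(_ isT); lia.
have hky : hi k <= y by rewrite hi_val.
case: (pickP (fun j => J j && (hi k <= j < y))) => [j /andP[Jj hj]|none]; last first.
  apply: (row_boundary (i := k)) => // j hj; have := none j.
  by rewrite hj andbT => /negbT.
apply: (@ltn_trans (row_of B ((z^-1)%g (hi k)))).
  by apply: (IHm _ _ j (hi k) (erefl _)) => //; rewrite hi_val; lia.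
by apply: (row_boundary (i := k)) => // l; lia.
Qed.

(** If [J] misses the range of values, a left descent of z in it can be undone within the support,
    with fewer inversions and without enlarging the range. If there is none, the values of the range
    occur in increasing order, against the descent at d. *)
Lemma descent_separated z d : supp z -> d \in A ->
  exists2 i, J i & z (hi d) <= i < z (lo d).
Proof.
move: {2}#|inversions z| (erefl #|inversions z|) => m.
elim/ltn_ind: m z => m IHm z zm sz dA.
case: (pickP (fun i : 'I_n => J i && (z (hi d) <= i < z (lo d)))) => [i /andP[]|none].
  by exists i.
have /descent_classP[zA _] := supp_in sz.
have lt := zA _ dA.
case: (pickP (fun i : 'I_n => desL i z && (z (hi d) <= i < z (lo d)))) => [i /andP[di]|nod].
  move=> /andP[h1 h2]; have nJ : ~~ J i.
    by have := none i; rewrite h1 h2 !andbT => /negbT.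
  have ss : supp (swap i z) by apply: supp_swap => //; rewrite di.
  have [|k Jk hk] := IHm #|inversions (swap i z)| _ (swap i z) (erefl _) ss dA.
    by rewrite -zm card_inversions_swap di; have := card_inversions_desL di; lia.
  have := none k; rewrite Jk /=.
  suff -> : z (hi d) <= k < z (lo d) by [].
  move: hk; rewrite !swapE !simpleE.
  do ![case: eqP => [/(congr1 (@nat_of_ord _))|_]]; rewrite ?lo_val ?hi_val; lia.
have : (z^-1)%g (z (hi d)) < (z^-1)%g (z (lo d)).
  apply: ascR_chain lt _ => j hj; have := nod j; rewrite hj andbT => /negbT.
  by have := desL_swap j z; rewrite /desL !swapV simple_lo simple_hi => ->.
by rewrite !permK lo_val hi_val; lia.
Qed.

(** Let i be as in [descent_separated]: values above i stand before the others. If z p < z q, then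
    according to the place of i one of the pairs (d+1, q), (p, q), (p, d) would be out of order. *)
Lemma supp_ordered z d p q : supp z -> d \in A -> p <= d < q -> z q < z p.
Proof.
move=> sz dA /andP[pd dq]; rewrite ltnNge; apply/negP => le.
have {le} lt : z p < z q.
  rewrite ltn_neqAle le andbT -ord_eqE (inj_eq perm_inj) ord_eqE; apply/eqP; lia.
have rowle x y : x <= y -> (row_of B y < row_of B x) = false.
  by move/(@row_of_le _ B); rewrite leqNgt => /negbTE.
have sep i x y : J i -> z x <= i < z y -> y < x.
  move=> Ji h; have := row_separated sz Ji h; rewrite !permK; exact: row_of_lt.
have [i Ji /andP[h1 h2]] := descent_separated sz dA.
have pq : p < q by lia.
case: (ltnP i (z p)) => ip.
  have := sep i (hi d) q Ji; rewrite h1 (ltn_trans ip lt) => /(_ isT).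
  by rewrite hi_val; lia.
case: (ltnP i (z q)) => iq.
  by have := sep i p q Ji; rewrite ip iq => /(_ isT); lia.
by have := sep i p (lo d) Ji; rewrite ip h2 => /(_ isT); rewrite lo_val; lia.
Qed.
End Socle.

(** * Essential embedding by a translation *)

Section Embedding.
Variables (F : fieldType) (n : nat) (A B : {set 'I_n}) (C : {set 'S_n.+1}) (k : 'S_n.+1).
Local Notation I := (descent_class A B).
Hypothesis C_convex : convexL C.
Hypothesis C_sub : forall s, s \in C -> (k * s)%g \in I.
Hypothesis C_desL : forall s i, s \in C -> desL i (k * s)%g = desL i s.
Hypothesis C_swap : forall s i, s \in C -> ~~ desL i s -> swap i s \notin C ->
  swap i (k * s)%g \notin I.
Hypothesis C_ordered : forall z, z \in I ->
  (forall d (p q : 'I_n.+1), d \in A -> p <= d < q -> z q < z p) -> (k^-1 * z)%g \in C.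

Definition embed : Defs.B F C -> Defs.B F I := linext (fun s => eB F I (k * s)%g).

Lemma coef_embed v s : s \in C -> coef (embed v) (k * s)%g = coef v s.
Proof.
move=> sC; rewrite coef_sum (bigD1 s) //= big1 => [|r rs].
  by rewrite coefZ coef_eB C_sub // eqxx mulr1 addr0.
rewrite coefZ coef_eB (inj_eq (mulgI k)) eq_sym (negbTE rs) andbF.
by rewrite mulr0.
Qed.

Lemma embed_hom : is_hom embed.
Proof.
apply: hom_linext => [|i s sC]; first exact/B_is_H0_module/descent_class_convex.
rewrite pi_eB ?C_sub //.
have -> : up i (k * s)%g = (k * up i s)%g.
  by rewrite /up C_desL //; case: ifP => // _; rewrite /swap /pcomp mulgA.
case: ifPn => // nC; apply: eB_notin.
have d : ~~ desL i s by apply: contra nC => d; rewrite (upT d).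
rewrite (upF (negbTE d)) in nC *; have := C_swap sC d nC.
by rewrite /swap /pcomp mulgA.
Qed.

Lemma embed_injective : injective embed.
Proof.
by move=> v w e; apply: coef_inj => s sC; rewrite -!coef_embed // e.
Qed.

(** The eigenvector found in U lies itself in the image: by [supp_ordered] and [C_ordered] its
    support is contained in the translate of [C]. *)
Lemma embed_essential : essential embed.
Proof.
move=> U subU [u Uu u0].
have [w [Uw w0 eig]] := common_eigenvector subU Uu u0.
pose v : Defs.B F C := mkB C (fun s => coef w (k * s)%g).
suff e : embed v = w by exists v; rewrite e.
apply: coef_inj => z zI; rewrite -[z](mulKVg k); set s := (k^-1 * z)%g.
have [sC|sC] := boolP (s \in C); first by rewrite coef_embed // coef_mkB sC.
transitivity (0%R : F); last first.
  apply/esym/eqP; apply: contraNT sC => wz; rewrite mulKVg in wz.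
  by apply: C_ordered => // d p q dA h; apply: (supp_ordered eig wz dA h).
rewrite coef_sum big1 // => r _; rewrite coefZ coef_eB (inj_eq (mulgI k)).
have [rs|] := eqVneq s r; last by rewrite andbF mulr0.
by rewrite -rs coef_notin // mul0r.
Qed.

Lemma descent_class_hull : is_injective_hull (Defs.B F I) (Defs.B F C).
Proof.
split; first exact: B_fg.
- exact/B_fg/descent_class_convex.
- exact: descent_class_injective.
by exists embed; split; [exact: embed_hom|exact: embed_injective|exact: embed_essential].
Qed.
End Embedding.

(** * Diagrams *)

Lemma count_prefix (T : Type) (x0 : T) (P : pred T) s :
  (forall i j, i < j < size s -> P (nth x0 s j) -> P (nth x0 s i)) ->
  forall i, i < size s -> P (nth x0 s i) = (i < count P s).
Proof.
elim: s => [|x s IHs] //= H i.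
have Hs i' j' : i' < j' < size s -> P (nth x0 s j') -> P (nth x0 s i').
  by move=> ij; apply: (H i'.+1 j'.+1).
case Px: (P x); case: i => [|i] //= lt; rewrite ?Px ?add1n ?ltnS.
- by rewrite IHs.
- suff -> : count P s = 0 by [].
  apply/eqP; rewrite -leqn0 leqNgt -has_count; apply/negP => /(has_nthP x0)[j js Pj].
  by have := H 0 j.+1 js Pj; rewrite /= Px.
have -> : count P s = 0.
  apply/eqP; rewrite -leqn0 leqNgt -has_count; apply/negP => /(has_nthP x0)[j js Pj].
  by have := H 0 j.+1 js Pj; rewrite /= Px.
by apply/negP => Pi; have := H 0 i.+1 lt Pi; rewrite /= Px.
Qed.

Lemma sumn_count_fibers (T : Type) (U : eqType) (f : T -> U) (s : seq T) (ys : seq U) :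
  uniq ys -> sumn [seq count (fun b => f b == y) s | y <- ys] = count (fun b => f b \in ys) s.
Proof.
elim: ys => [|y ys IHys] /=; first by rewrite count_pred0.
case/andP => yys uys; rewrite IHys // -count_predUI.
rewrite [X in _ + X](@eq_count _ _ pred0) => [|b] /=; last first.
  by apply/andP => -[/eqP ->]; apply/negP.
by rewrite count_pred0 addn0; apply: eq_count => b; rewrite /= inE.
Qed.

(* The images in the diagram of the boxes of tcd(alpha) are sorted by this order
   when the boxes are read as in [word_RB]. *)
Definition RB_order : rel box :=
  fun b c => (b.1 < c.1) || ((b.1 == c.1) && (c.2 <= b.2)).

Definition box_le : rel box := fun b c => (b.1 <= c.1) && (b.2 <= c.2).

Lemma row_order_total : total row_order.
Proof. by move=> [a b] [c d]; rewrite /row_order /=; lia. Qed.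
Lemma row_order_trans : transitive row_order.
Proof. by move=> [a b] [c d] [e f]; rewrite /row_order /=; lia. Qed.
Lemma column_order_total : total column_order.
Proof. by move=> [a b] [c d]; rewrite /column_order /=; lia. Qed.
Lemma column_order_trans : transitive column_order.
Proof. by move=> [a b] [c d] [e f]; rewrite /column_order /=; lia. Qed.
Lemma RB_order_total : total RB_order.
Proof. by move=> [a b] [c d]; rewrite /RB_order /=; lia. Qed.
Lemma RB_order_trans : transitive RB_order.
Proof. by move=> [a b] [c d] [e f]; rewrite /RB_order /=; lia. Qed.

Section Diagram.
Variables (n : nat) (D : seq box).
Hypothesis D_uniq : uniq D.
Hypothesis D_size : size D = n.+1.
Implicit Types (p q : 'I_n.+1) (i j : 'I_n).

Let pt0 : box := (0, 0).

Section SortedPoints.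
Variable r : rel box.
Hypotheses (r_total : total r) (r_trans : transitive r).

Definition point p := nth pt0 (sort r D) p.

Lemma point_mem p : point p \in D.
Proof. by rewrite -(mem_sort r) mem_nth // size_sort D_size. Qed.

Lemma point_inj : injective point.
Proof.
by move=> p q /eqP; rewrite nth_uniq ?sort_uniq ?size_sort ?D_size // => /eqP/ord_inj.
Qed.

Lemma point_lt p q : p < q -> r (point p) (point q).
Proof.
move=> pq; apply: (sorted_ltn_nth r_trans) => //; first exact: sort_sorted.
  by rewrite inE size_sort D_size.
by rewrite inE size_sort D_size.
Qed.

Lemma point_surj b : b \in D -> exists p, point p = b.
Proof.
move=> bD; have bs : b \in sort r D by rewrite mem_sort.
have lt : index b (sort r D) < n.+1 by rewrite -D_size -(size_sort r) index_mem.
by exists (Ordinal lt); rewrite /point nth_index.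
Qed.

End SortedPoints.

Local Notation L := (point row_order).
Local Notation K := (point RB_order).

Lemma box_eqE (b c : box) : (b == c) = (b.1 == c.1) && (b.2 == c.2).
Proof. by []. Qed.

Lemma L_lt p q : (p < q) =
  ((L q).2 < (L p).2) || (((L p).2 == (L q).2) && ((L p).1 < (L q).1)).
Proof.
have lt (x y : 'I_n.+1) : x < y -> ((L y).2 < (L x).2) || (((L x).2 == (L y).2) && ((L x).1 < (L y).1)).
  move=> xy; have := point_lt row_order_total row_order_trans xy.
  have : L x != L y.
    rewrite (inj_eq (@point_inj row_order)); apply/eqP => e.
    by rewrite e ltnn in xy.
  by rewrite box_eqE /row_order; case: (L x) (L y) => a b [c d] /=; lia.
case: (ltngtP p q) => [/lt -> //|/lt|/ord_inj ->].
  by case: (L p) (L q) => a b [c d] /=; lia.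
by rewrite !ltnn andbF.
Qed.

Lemma K_lt p q : (p < q) =
  ((K p).1 < (K q).1) || (((K p).1 == (K q).1) && ((K q).2 < (K p).2)).
Proof.
have lt (x y : 'I_n.+1) : x < y -> ((K x).1 < (K y).1) || (((K x).1 == (K y).1) && ((K y).2 < (K x).2)).
  move=> xy; have := point_lt RB_order_total RB_order_trans xy.
  have : K x != K y.
    rewrite (inj_eq (@point_inj RB_order)); apply/eqP => e.
    by rewrite e ltnn in xy.
  by rewrite box_eqE /RB_order; case: (K x) (K y) => a b [c d] /=; lia.
case: (ltngtP p q) => [/lt -> //|/lt|/ord_inj ->].
  by case: (K p) (K q) => a b [c d] /=; lia.
by rewrite !ltnn andbF.
Qed.

Let A := DesL (perm_of_word n (word_BL D (row_filling D))).
Let B := comp_set n (row_counts D).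

Lemma mem_A i : (i \in A) = ((L (hi i)).1 <= (L (lo i)).1).
Proof.
pose w := perm_of_word n (word_BL D (row_filling D)).
(* [w] sends p to the row-reading number of the p-th point of the column reading, so i is a left
   descent when [L (hi i)] is met before [L (lo i)] in columns. *)
have wE p : L (w p) = point column_order p.
  have := perm_of_wordK (n := n) (w := word_BL D (row_filling D)).
  have pw : perm_eq (word_BL D (row_filling D)) (iota 1 n.+1).
    have e : perm_eq (sort column_order D) (sort row_order D).
      by rewrite perm_sort perm_sym perm_sort.
    have := perm_map (row_filling D) e; rewrite -/(word_BL _ _) => /perm_trans; apply.
    rewrite /row_filling (_ : [seq _ | b <- _] = iota 1 n.+1) //.
    apply: (@eq_from_nth _ 0); rewrite size_map size_sort D_size ?size_iota // => k kn.
    rewrite (nth_map pt0) ?size_sort ?D_size // nth_iota // index_uniq ?size_sort ?D_size //.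
    by rewrite sort_uniq.
  move=> /(_ pw) /(congr1 (fun s => nth 0 s p)).
  rewrite /oneline (nth_map ord0) ?size_enum_ord // nth_ord_enum.
  rewrite /word_BL (nth_map pt0) ?size_sort ?D_size // => -[e].
  rewrite /point -/w in e *; rewrite e nth_index //.
  by rewrite mem_sort -(mem_sort column_order) mem_nth ?size_sort ?D_size.
rewrite mem_DesL -/w; set P := (w^-1)%g (lo i); set Q := (w^-1)%g (hi i).
have -> : desL i w = (Q < P) by [].
have eP : L (lo i) = point column_order P by rewrite -wE permKV.
have eQ : L (hi i) = point column_order Q by rewrite -wE permKV.
have := L_lt (lo i) (hi i); rewrite lo_hi eP eQ.
case: (ltngtP Q P) => [lt|lt|/ord_inj e].
- by have := point_lt column_order_total column_order_trans lt; rewrite /column_order; lia.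
- by have := point_lt column_order_total column_order_trans lt; rewrite /column_order; lia.
by rewrite e !ltnn andbF.
Qed.

(** The points above a given height form an initial segment of the row reading. Hence a partial sum
    of row counts is the position, counted from 0, of the first point of a row; i+1 is that position
    for [hi i]. *)
Lemma mem_B i : (i \in B) = ((L (hi i)).2 < (L (lo i)).2).
Proof.
pose ys := sort geq (undup [seq b.2 | b <- D]).
have geq_tr : transitive geq by move=> x y z; rewrite /geq /=; lia.
have geq_tot : total geq by move=> x y; rewrite /geq /=; lia.
have uys : uniq ys by rewrite sort_uniq undup_uniq.
have mys b : b \in D -> b.2 \in ys by move=> bD; rewrite mem_sort mem_undup map_f.
have idx k y : k < size ys -> y \in ys -> (y \in take k ys) = (nth 0 ys k < y).
  move=> ks yys; rewrite in_take //; have il : index y ys < size ys by rewrite index_mem.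
  have ye := nth_index 0 yys.
  have srt : sorted geq ys by apply: sort_sorted.
  have ne a b : a < b -> b < size ys -> nth 0 ys b < nth 0 ys a.
    move=> ab bs; have as_ := ltn_trans ab bs.
    have := sorted_ltn_nth geq_tr 0 srt a b as_ bs ab; rewrite /geq /= leq_eqVlt.
    by rewrite nth_uniq // => /orP[/eqP ba|//]; rewrite ba ltnn in ab.
  case: (ltngtP (index y ys) k) => [lt|lt|e]; last by rewrite -e ye ltnn.
    by have := ne _ _ lt ks; rewrite ye => ->.
  by have := ne _ _ lt il; rewrite ye; lia.
have szL : size (sort row_order D) = n.+1 by rewrite size_sort.
have cnt k : k < size ys -> sumn (take k (row_counts D)) =
    count (fun b => nth 0 ys k < b.2) (sort row_order D).
  move=> ks; rewrite /row_counts -/ys -map_take sumn_count_fibers ?take_uniq //.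
  have /seq.permP <- : perm_eq (sort row_order D) D by rewrite perm_sort.
  apply: eq_in_count => b; rewrite mem_sort => bD; apply: idx => //; exact: mys.
have pre y p : (y < (L p).2) = (p < count (fun b => y < b.2) (sort row_order D)).
  apply: (@count_prefix _ pt0 (fun b => y < b.2)); last by rewrite szL.
  move=> a b; rewrite szL => /andP[ab bn].
  by have := L_lt (Ordinal (ltn_trans ab bn)) (Ordinal bn); rewrite /point /= ab; lia.
have szrc : size (row_counts D) = size ys by rewrite size_map.
rewrite inE; apply/mapP/idP => [[k]|lt].
  rewrite mem_iota szrc => kk; have ks : k < size ys by lia.
  rewrite cnt // => e; have := pre (nth 0 ys k) (lo i); have := pre (nth 0 ys k) (hi i).
  by rewrite -e lo_val hi_val ltnn leqnn; lia.
have hy : (L (hi i)).2 \in ys by apply/mys/point_mem.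
have ks : index (L (hi i)).2 ys < size ys by rewrite index_mem.
exists (index (L (hi i)).2 ys).
  rewrite mem_iota szrc; suff : 0 < index (L (hi i)).2 ys by lia.
  have ly : (L (lo i)).2 \in ys by apply/mys/point_mem.
  have := idx _ _ ks ly; rewrite nth_index // lt in_take //; lia.
rewrite cnt // nth_index //; have := pre (L (hi i)).2 (lo i); have := pre (L (hi i)).2 (hi i).
by rewrite ltnn lt lo_val hi_val; lia.
Qed.

Variable C : {set 'S_n.+1}.
Hypothesis mem_C : forall s : 'S_n.+1, reflect
  (forall p q, p != q -> box_le (K p) (K q) -> s p < s q) (s \in C).
Hypothesis gap : forall b c, b \in D -> c \in D -> b.1 < c.1 -> b.2 < c.2 ->
  exists e, [/\ e \in D, e != b, e != c, box_le b e & box_le e c].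

Lemma diagram_convex : convexL C.
Proof.
move=> x y z /mem_C xC /mem_C zC /subsetP xy /subsetP yz; apply/mem_C => p q pq le.
have := pq; rewrite -val_eqE neq_ltn => /orP[lt|lt].
  rewrite ltn_neqAle -ord_eqE (inj_eq perm_inj) pq leqNgt; apply/negP => lt'.
  have /yz/inversionsP[_] : (p, q) \in inversions y by apply/inversionsP.
  by rewrite ltnNge ltnW // zC.
have /xy/inversionsP[//] : (q, p) \in inversions x.
by apply/inversionsP; split=> //; apply: xC.
Qed.

Let k_fun p : 'I_n.+1 := inord (index (L p) (sort RB_order D)).

Lemma k_fun_inj : injective k_fun.
Proof.
have lt p : index (L p) (sort RB_order D) < n.+1.
  by rewrite -D_size -(size_sort RB_order) index_mem mem_sort point_mem.
move=> p q /(congr1 (@nat_of_ord _)); rewrite !inordK // => e.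
apply: (point_inj (r := row_order)).
rewrite -(nth_index pt0 (s := sort RB_order D) (x := L p)) ?mem_sort ?point_mem // e.
by rewrite nth_index // mem_sort point_mem.
Qed.

Let k : 'S_n.+1 := perm k_fun_inj.

Lemma K_k p : K (k p) = L p.
Proof.
rewrite permE /point /k_fun inordK ?nth_index ?mem_sort ?point_mem //.
by rewrite -D_size -(size_sort RB_order) index_mem mem_sort point_mem.
Qed.

Lemma L_kV p : L ((k^-1)%g p) = K p.
Proof. by rewrite -K_k permKV. Qed.

Local Notation I := (descent_class A B).

(** A point in between would carry a value strictly between i and i+1. *)
Lemma no_gap s i : s \in C ->
  ~ ((K ((s^-1)%g (lo i))).1 < (K ((s^-1)%g (hi i))).1 /\
     (K ((s^-1)%g (lo i))).2 < (K ((s^-1)%g (hi i))).2).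
Proof.
move=> /mem_C sC [lt1 lt2].
have [e [eD eb ec be ce]] := gap (point_mem _ _) (point_mem _ _) lt1 lt2.
have [r re] := point_surj RB_order eD; rewrite -re in eb ec be ce.
rewrite !(inj_eq (@point_inj RB_order)) in eb ec.
have := sC _ _ _ be; rewrite permKV => h1; have := sC _ _ _ ce; rewrite permKV => h2.
have := h1; rewrite eq_sym => /(_ eb); have := h2 ec.
by rewrite lo_val hi_val; lia.
Qed.

Lemma not_below s i : s \in C -> ~~ box_le (K ((s^-1)%g (hi i))) (K ((s^-1)%g (lo i))).
Proof.
move=> /mem_C sC; apply/negP => /sC; rewrite !permKV (inj_eq perm_inj) ord_eqE.
by rewrite lo_val hi_val; lia.
Qed.

(** The two readings disagree only on pairs of points in strict north-east position; [no_gap]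
    excludes one direction and [not_below] the other. *)
Lemma diagram_desL s i : s \in C -> desL i (k * s)%g = desL i s.
Proof.
move=> sC; rewrite /desL invMg !permM L_lt K_lt !L_kV.
have := not_below i sC; have := no_gap (i := i) sC; rewrite /box_le.
by move: (K _) (K _) => [a b] [c d] /=; lia.
Qed.

Lemma not_mem_B p q j : p <= j < q -> (L p).2 = (L q).2 -> j \notin B.
Proof.
move=> /andP[pj jq] e; rewrite mem_B.
have le (x y : 'I_n.+1) : x <= y -> (L y).2 <= (L x).2.
  by rewrite leq_eqVlt => /orP[/eqP/ord_inj -> //|]; rewrite L_lt; lia.
have h1 := le p (lo j) pj; have h2 : (L q).2 <= (L (hi j)).2 by apply: le; rewrite hi_val.
rewrite -e in h2; apply/negP => lt; have := leq_ltn_trans h2 (leq_trans lt h1).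
by rewrite ltnn.
Qed.

Lemma diagram_sub s : s \in C -> (k * s)%g \in I.
Proof.
move=> /mem_C sC; apply/descent_classP.
have ne j : k (lo j) != k (hi j).
  by rewrite (inj_eq perm_inj) ord_eqE lo_val hi_val; apply/eqP; lia.
have ord j := L_lt (lo j) (hi j).
split=> j; rewrite ?mem_A ?mem_B => h; rewrite !permM; apply: sC;
    rewrite ?ne // 1?eq_sym ?ne // /box_le !K_k; have := ord j; rewrite lo_hi; lia.
Qed.

(** Leaving [C] means that the points of i and i+1 are comparable. By [no_gap] they share a row or a
    column; in a column the higher point is read first, so P < Q leaves a row, where the exchange
    creates a descent outside [B]. *)
Lemma diagram_swap s i : s \in C -> ~~ desL i s -> swap i s \notin C ->
  swap i (k * s)%g \notin I.
Proof.
move=> sC d nC; set P := (s^-1)%g (lo i); set Q := (s^-1)%g (hi i).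
have PQ : P < Q by have := desL_swap i s; rewrite d /desL !swapV simple_lo simple_hi.
have le : box_le (K P) (K Q).
  apply: contraNT nC => nle; apply/mem_C => p q pq le.
  have /mem_C/(_ _ _ pq le) lt := sC.
  rewrite !swapE simple_lt lt; case: ifP => [/andP[]|_]; last by case: ifP.
  by rewrite !eq_permV => /eqP pP /eqP qQ; rewrite pP qQ (negbTE nle) in le.
have e2 : (L ((k^-1)%g P)).2 = (L ((k^-1)%g Q)).2.
  rewrite !L_kV; have := K_lt P Q; rewrite PQ; have := no_gap (i := i) sC.
  by move: le; rewrite /box_le -/P -/Q; lia.
have lt : (k^-1)%g P < (k^-1)%g Q.
  by rewrite L_lt e2 ltnn eqxx /= !L_kV; have := K_lt P Q; rewrite PQ !L_kV in e2 *; lia.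
apply/negP => /descent_classP[_ zB].
have : swap i (k * s)%g ((k^-1)%g P) < swap i (k * s)%g ((k^-1)%g Q).
  by apply: ascR_chain lt _ => j /not_mem_B h; apply/zB/h.
by rewrite !swapE !permM !permKV simple_lo simple_hi lo_val hi_val; lia.
Qed.

Lemma diagram_ordered z : z \in I ->
  (forall d p q, d \in A -> p <= d < q -> z q < z p) -> (k^-1 * z)%g \in C.
Proof.
move=> /descent_classP[_ zB] zA; apply/mem_C => p q pq; rewrite -!L_kV !permM.
move: ((k^-1)%g p) ((k^-1)%g q) (inj_eq (@perm_inj _ (k^-1)%g) p q) => {}p' {}q' e.
have {e pq} pq : p' != q' by rewrite e.
rewrite /box_le => /andP[le1 le2].
have [e2|ne2] := eqVneq (L p').2 (L q').2.
  have lt : p' < q'.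
    rewrite L_lt e2 ltnn eqxx /= ltn_neqAle le1 andbT.
    apply: contra pq => /eqP e1; rewrite -(inj_eq (@point_inj row_order)) box_eqE.
    by rewrite e1 e2 !eqxx.
  by apply: ascR_chain lt _ => j /not_mem_B h; apply/zB/h.
have lt : q' < p' by rewrite L_lt ltn_neqAle ne2 le2.
(* With no cut of [A] in between, the columns would strictly increase from q' to p'. *)
case: (pickP (fun d : 'I_n => (d \in A) && (q' <= d < p'))) => [d /andP[dA h]|none].
  exact: zA dA h.
have : (L q').1 < (L p').1; last by lia.
apply: (ord_chain (f := fun x => (L x).1)) lt _ => j h.
by have := none j; rewrite h andbT mem_A => /negbT; rewrite -ltnNge.
Qed.

Lemma diagram_hull (F : fieldType) :
  is_injective_hull (Defs.B F (intervalL (w0 A) (w1 B))) (Defs.B F C).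
Proof.
rewrite intervalLE; apply: (descent_class_hull F diagram_convex diagram_sub).
- by move=> s i; apply: diagram_desL.
- by move=> s i; apply: diagram_swap.
- exact: diagram_ordered.
Qed.
End Diagram.

(** * The chains Y_j *)

Section Composition.
Variable alpha : seq nat.

Local Notation l := (size alpha).
Local Notation part := (part alpha).
Local Notation tcd := (tcd alpha).
Local Notation BB := (BB alpha).

Definition is_box k r := [&& 0 < k, 0 < r <= l & k <= part r].

Lemma is_box_left k k' r : 0 < k -> k <= k' -> is_box k' r -> is_box k r.
Proof. by rewrite /is_box; lia. Qed.

Lemma mem_tcd k r : ((k, r) \in tcd) = is_box k r.
Proof.
apply/allpairsPdep/idP => [[i [j [+ + [-> ->]]]]|/and3P[k0 rl kp]].
  by rewrite !mem_iota /is_box; lia.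
by exists r, k; rewrite !mem_iota; split=> //; lia.
Qed.

Lemma tcd_uniq : uniq tcd.
Proof.
apply: allpairs_uniq_dep => [||[i j] [i' j'] _ _ /= [-> ->] //]; first exact: iota_uniq.
by move=> i _; exact: iota_uniq.
Qed.

Lemma size_tcd : size tcd = sumn alpha.
Proof.
rewrite size_allpairs_dep; congr sumn; apply: (@eq_from_nth _ 0); rewrite !size_map ?size_iota // => i il.
by rewrite (nth_map 0) ?size_iota // nth_iota // size_iota /part add1n.
Qed.

Definition rows_from (P : pred nat) a := [seq y <- iota a (l.+1 - a) | P y].

Lemma rows_fromP P a :
  match rows_from P a with
  | [::] => forall y, a <= y <= l -> ~~ P y
  | y :: _ => [/\ a <= y <= l, P y & forall y', a <= y' < y -> ~~ P y']
  end.
Proof.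
rewrite /rows_from; move: {2}(l.+1 - a) (erefl (l.+1 - a)) => m.
elim: m a => [|m IHm] a am; rewrite am /=; first by move=> y; lia.
case Pa: (P a).
  by split=> //; [lia|move=> y'; lia].
have := IHm a.+1; rewrite (_ : l.+1 - a.+1 = m); last by lia.
move=> /(_ erefl); case: [seq y <- _ | _] => [H y|y s [ay Py H]].
  rewrite leq_eqVlt => /andP[/orP[/eqP <-|ay] yl]; first by rewrite Pa.
  by apply: H; rewrite ay.
split=> //; first by lia.
move=> y'; rewrite leq_eqVlt => /andP[/orP[/eqP <-|ay'] yl]; first by rewrite Pa.
by apply: H; rewrite ay'.
Qed.

(* Within a chain Y_j, the box (k.+2, r) is preceded by the box of column k.+1
   in the first row above r that has one; in column 1, a box in a row of length 1
   is preceded by the box above it.  [root k r] is the box of BB from which the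
   chain through (k, r) starts. *)
Fixpoint root k r : box :=
  match k with
  | 0 => (0, r)
  | k'.+1 =>
    if k' == 0 then (1, head l (rows_from (fun y => 1 < part y) r))
    else if rows_from (fun y => k' <= part y) r.+1 is r1 :: _ then root k' r1
    else (k, r)
  end.

Lemma root1 r : root 1 r = (1, head l (rows_from (fun y => 1 < part y) r)).
Proof. by []. Qed.

Lemma rootSS k r : root k.+2 r =
  if rows_from (fun y => k.+1 <= part y) r.+1 is r1 :: _ then root k.+1 r1
  else (k.+2, r).
Proof. by []. Qed.

Lemma root_col k r : (root k r).1 <= k.
Proof.
elim: k r => [|[|k] IHk] r //; rewrite rootSS; case: rows_from => //= r1 _.
exact: leq_trans (IHk r1) _.
Qed.

Lemma mem_BB b : (b \in BB) = (b \in tcd) && in_BB alpha b.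
Proof. by rewrite mem_sort mem_filter andbC. Qed.

Lemma in_BB_col k r : is_box k.+2 r ->
  reflect (forall y, r.+1 <= y <= l -> ~~ (k.+1 <= part y)) (in_BB alpha (k.+2, r)).
Proof.
move=> bkr; apply: (iffP hasPn) => /= [H y /andP[ry yl]|H [x y]].
  apply/negP => ky; have := H (k.+1, y); rewrite mem_tcd /is_box ky yl (leq_trans _ ry) //=.
  by move=> /(_ isT); rewrite eqxx orbT ry.
rewrite mem_tcd => /and3P[x0 yl xp] /=; apply/negP => /andP[xk ry].
have := H y; rewrite ry; move/andP: yl => [_ ->] /(_ isT) /negP; apply.
by case/orP: xk => /eqP xk; lia.
Qed.

Hypothesis alpha_pos : all (leq 1) alpha.
Hypothesis alpha_nil : alpha != [::].

Lemma l_gt0 : 0 < l. Proof. by case: alpha alpha_nil. Qed.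

Lemma part_gt0 y : 0 < y <= l -> 0 < part y.
Proof.
case: y => // y yl; apply: (allP alpha_pos); exact: mem_nth.
Qed.

Lemma root_BB k r : is_box k r -> root k r \in BB.
Proof.
elim: k r => [|[|k] IHk] r bkr; first by case/andP: bkr.
  rewrite root1 mem_BB; have := rows_fromP (fun y => 1 < part y) r.
  case: rows_from => [|y _] /=.
    by move=> _; rewrite mem_tcd /in_BB /is_box /= eqxx part_gt0 l_gt0 leqnn.
  case=> ry py _; rewrite mem_tcd /in_BB /is_box /= py orbT andbT (ltnW py) andbT.
  by case/and3P: bkr; lia.
rewrite rootSS; have := rows_fromP (fun y => k.+1 <= part y) r.+1.
case: rows_from => [|r1 _] /= H.
  by rewrite mem_BB mem_tcd bkr; apply/in_BB_col.
by case: H => rr1 pr1 _; apply: IHk; rewrite /is_box pr1; case/and3P: bkr; lia.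
Qed.

Lemma root_id k r : (k, r) \in BB -> root k r = (k, r).
Proof.
rewrite mem_BB mem_tcd => /andP[bkr inb].
case: k bkr inb => [|[|k]] bkr inb //.
  rewrite root1; have H := rows_fromP (fun y => 1 < part y) r.
  case/and3P: bkr => _ rl _; move: inb; rewrite /in_BB /=.
  case: rows_from H => [|y _] /= H.
    by case/orP => [/eqP -> //|p]; have := H r; rewrite p; lia.
  case: H => ry py H; have [-> //|ne] := eqVneq y r.
  by case/orP => [/eqP e|p]; [lia|have := H r; rewrite p; lia].
rewrite rootSS; have := rows_fromP (fun y => k.+1 <= part y) r.+1.
case: rows_from => // r1 _ [rr1 pr1 _].
by have := in_BB_col bkr inb _ rr1; rewrite pr1.
Qed.

Lemma BB_uniq : uniq BB.
Proof. by rewrite sort_uniq filter_uniq // tcd_uniq. Qed.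

Lemma BB_index_lt b c : b \in BB -> c \in BB ->
  (b.1 < c.1) || ((b.1 == c.1) && (b.2 < c.2)) -> index b BB < index c BB.
Proof.
move=> bB cB lt; rewrite ltnNge; apply/negP => le.
have srt : sorted column_order BB by apply: sort_sorted; exact: column_order_total.
have refl : reflexive column_order by move=> [x y]; rewrite /column_order /= !leqnn eqxx orbT.
have := sorted_leq_nth column_order_trans refl (0, 0) srt (index c BB) (index b BB).
rewrite !inE !index_mem bB cB le !nth_index // => /(_ isT isT isT).
by move: lt; rewrite /column_order; case: (b) (c) => x y [x' y'] /=; lia.
Qed.

(* The j such that the box (k, r) lies in Y_j *)
Definition ix k r := (index (root k r) BB).+1.

Lemma ix_lt_col k r k' r' : is_box k r -> is_box k' r' ->
  (root k r).1 < (root k' r').1 -> ix k r < ix k' r'.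
Proof. by move=> b b' lt; rewrite /ix ltnS BB_index_lt ?root_BB // lt. Qed.

(** In column 1 the index grows just above each row of length at least 2. In a later column, the
    predecessors of the two boxes lie in rows r1 <= r' < r1', and row r' separates their indices by
    induction; a box without predecessor is its own root, in a column beyond those of earlier
    roots. *)
Lemma ix_mono k r r' : is_box k r -> is_box k r' -> r < r' ->
  ix k r <= ix k r' /\ ((1 < k) || (1 < part r) -> ix k r < ix k r').
Proof.
elim: k r r' => [|[|k] IHk] r r' b b' rr'; first by case/andP: b.
  have le : (root 1 r).2 <= (root 1 r').2 /\ (1 < part r -> (root 1 r).2 < (root 1 r').2).
    rewrite !root1 /=; have := rows_fromP (fun y => 1 < part y) r.
    have := rows_fromP (fun y => 1 < part y) r'.
    case/and3P: b => _ rl _; case/and3P: b' => _ rl' _.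
    case: rows_from => [|y' s'] /=; case: rows_from => [|y s] /=.
    - by move=> _ H; split=> // p; have := H r; rewrite p; lia.
    - move=> _ [ry py H]; split; first by lia.
      by move=> p; have := H r; rewrite p; lia.
    - by move=> [ry py H] H'; have := H' y'; rewrite py; lia.
    move=> [ry' py' H'] [ry py H]; split.
      rewrite leqNgt; apply/negP => lt; have := H y'; rewrite py'; lia.
    by move=> p; have := H r; rewrite p; lia.
  case: le => le lt; split=> [|/lt {}lt].
    move: le; rewrite leq_eqVlt => /orP[/eqP e|lt'].
      by rewrite /ix !root1 in e *; rewrite /= in e; rewrite e.
    by rewrite ltnW // /ix ltnS BB_index_lt ?root_BB //= lt' orbT.
  by rewrite /ix ltnS BB_index_lt ?root_BB //= lt orbT.
suff lt : ix k.+2 r < ix k.+2 r' by split=> //; apply: ltnW.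
have := rows_fromP (fun y => k.+1 <= part y) r.+1.
have := rows_fromP (fun y => k.+1 <= part y) r'.+1.
have E x : ix k.+2 x = (index (if rows_from (fun y => k.+1 <= part y) x.+1 is r1 :: _
  then root k.+1 r1 else (k.+2, x)) BB).+1 by [].
have bb := b; have bb' := b'.
case/and3P: b => _ rl kr; case/and3P: b' => _ rl' kr'.
case F: (rows_from _ r.+1) => [|r1 s1]; first by move=> _ H; have := H r'; lia.
case F': (rows_from _ r'.+1) => [|r1' s1'] H' [rr1 pr1 H].
  apply: ix_lt_col => //; rewrite !rootSS F F'.
  exact: leq_ltn_trans (root_col _ _) (ltnSn _).
case: H' => rr1' pr1' H'.
have r1r' : r1 <= r' by rewrite leqNgt; apply/negP => lt; have := H r'; lia.
rewrite !E F F' -/(ix k.+1 r1) -/(ix k.+1 r1').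
have b1 : is_box k.+1 r1 by rewrite /is_box pr1; lia.
have b1' : is_box k.+1 r1' by rewrite /is_box pr1'; lia.
have b2 : is_box k.+1 r' by rewrite /is_box; lia.
have le1 : ix k.+1 r1 <= ix k.+1 r'.
  move: r1r'; rewrite leq_eqVlt => /orP[/eqP -> //|lt].
  by have [] := IHk r1 r' b1 b2 lt.
apply: leq_ltn_trans le1 _; have [|_] := IHk r' r1' b2 b1'; first by lia.
by apply; apply/orP; right; lia.
Qed.

Lemma ix_right k r : 0 < k -> is_box k.+1 r -> ix k r < ix k.+1 r.
Proof.
case: k => // k _ b; have b1 : is_box k.+1 r by move: b; rewrite /is_box; lia.
have := rows_fromP (fun y => k.+1 <= part y) r.+1.
case F: (rows_from _ r.+1) => [|r1 s1].
  by move=> _; apply: ix_lt_col => //; rewrite [root k.+2 r]rootSS F ltnS root_col.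
move=> [rr1 pr1 _]; rewrite [ix k.+2 r]/ix rootSS F -/(ix k.+1 r1).
have [||_] := @ix_mono k.+1 r r1 b1; first by rewrite /is_box pr1; lia.
  by lia.
by apply; move: b; rewrite /is_box; lia.
Qed.

Lemma ix_up k r r' : 0 < k -> is_box k.+1 r -> is_box k r' -> r < r' ->
  ix k.+1 r <= ix k r'.
Proof.
case: k => // k _ b b' rr'; have := rows_fromP (fun y => k.+1 <= part y) r.+1.
have [rl' kr'] : 0 < r' <= l /\ k < part r' by case/and3P: b'.
rewrite [ix k.+2 r]/ix rootSS; case: rows_from => [|r1 s1].
  by move=> H; have := H r'; lia.
move=> [rr1 pr1 H]; have r1r' : r1 <= r'.
  by rewrite leqNgt; apply/negP => lt; have := H r'; lia.
move: r1r'; rewrite leq_eqVlt => /orP[/eqP -> //|lt].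
by have [] := @ix_mono k.+1 r1 r' _ b' lt; rewrite // /is_box pr1; lia.
Qed.

Lemma ix_row k k' r : 0 < k -> k < k' -> is_box k' r -> ix k r < ix k' r.
Proof.
move=> k0; elim: k' => // k' IHk'; rewrite ltnS leq_eqVlt => /orP[/eqP <-|kk'] b.
  exact: ix_right.
apply: ltn_trans (IHk' kk' _) (ix_right _ b); last by lia.
by move: b; rewrite /is_box; lia.
Qed.

(* In the canonical class all columns increase, so the triple condition on
   tableaux amounts to the last of these relations. *)
Definition generic (t : filling) :=
  [/\ forall k k' r, 0 < k -> k < k' -> is_box k' r -> t (k, r) < t (k', r),
      forall k r r', is_box k r -> is_box k r' -> r < r' -> t (k, r) < t (k, r')
    & forall k r r', 0 < k -> is_box k.+1 r -> is_box k r' -> r < r' ->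
        t (k.+1, r) < t (k, r')].

(** Serves two purposes at once: the first two conditions order the points of the diagram, the third
    one the entries. Strictness of the entries also keeps a box in between distinct from both
    ends. *)
Definition below b c := [/\ b.2 <= c.2, ix b.1 b.2 <= ix c.1 c.2 &
  forall t, generic t -> t b < t c].

Lemma below_trans a b c : below b a -> below a c -> below b c.
Proof.
move=> [r1 i1 t1] [r2 i2 t2]; split; [lia|lia|move=> t gt].
exact: ltn_trans (t1 t gt) (t2 t gt).
Qed.

Lemma below_row k k' r : 0 < k -> k < k' -> is_box k' r -> below (k, r) (k', r).
Proof.
by move=> k0 kk' b; split=> //=; [apply/ltnW/ix_row|move=> t [+ _ _]; apply].
Qed.

Lemma below_column k r r' : is_box k r -> is_box k r' -> r < r' -> below (k, r) (k, r').
Proof.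
move=> b b' rr'; split=> [||t [_ + _]]; [exact: ltnW| |exact].
by have [] := ix_mono b b' rr'.
Qed.

Lemma below_up k r r' : 0 < k -> is_box k.+1 r -> is_box k r' -> r < r' ->
  below (k.+1, r) (k, r').
Proof.
move=> k0 b b' rr'; split=> [||t [_ _]]; [exact: ltnW|exact: ix_up|exact].
Qed.

Lemma box_trichotomy k r k' r' : is_box k r -> is_box k' r' -> r < r' ->
  [\/ ix k' r' < ix k r, ix k r = ix k' r' /\ below (k, r) (k', r') |
    exists x y, [/\ is_box x y, below (k, r) (x, y) & below (x, y) (k', r')]].
Proof.
elim: k r k' r' => [|k IHk] r k' r' b b' rr'; first by case/andP: b.
case: (ltngtP k.+1 k') => [lt|gt|<-{k'}] in b' *.
- have b1 : is_box k.+1 r' by apply: is_box_left b'; rewrite // ltnW.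
  constructor 3; exists k.+1, r'; split=> //; first exact: below_column.
  exact: below_row.
- case: k IHk b gt => [|k] IHk b gt; first by case/andP: b' => k'0 _; lia.
  (* The upper box is in an earlier column. Step from (k.+2, r) to its predecessor (k.+1, r1), which
     is in the same chain and above it, and compare r1 with r'. *)
  have := rows_fromP (fun y => k.+1 <= part y) r.+1.
  case F: (rows_from _ r.+1) => [|r1 s1].
    move=> _; constructor 1; apply: ix_lt_col => //.
    by rewrite [root k.+2 r]rootSS F; apply: leq_ltn_trans (root_col _ _) _.
  move=> [rr1 pr1 H]; have b1 : is_box k.+1 r1 by rewrite /is_box pr1; lia.
  have e : ix k.+2 r = ix k.+1 r1 by rewrite [LHS]/ix rootSS F.
  have up : below (k.+2, r) (k.+1, r1) by apply: below_up => //; lia.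
  have k'0 : 0 < k' by case/andP: b'.
  case: (ltngtP r1 r') => [lt|lt|r1r'].
  + case: (IHk r1 k' r' b1 b' lt) => [lt'|[e' bel]|[x [y [bxy l1 l2]]]].
    * by constructor 1; rewrite e.
    * by constructor 2; rewrite e; split=> //; apply: below_trans up bel.
    * by constructor 3; exists x, y; split=> //; apply: below_trans up l1.
  + move: gt; rewrite ltnS leq_eqVlt => /orP[/eqP k'k|k'k].
      by have := H r'; rewrite k'k in b'; case/and3P: b' => _ _ ->; lia.
    constructor 1; rewrite e; have b2 : is_box k' r1 by apply: is_box_left b1; lia.
    have [le _] := ix_mono b' b2 lt; apply: leq_ltn_trans le _; exact: ix_row.
  move: gt; rewrite ltnS leq_eqVlt => /orP[/eqP k'k|k'k].
    by constructor 2; rewrite k'k -r1r' e.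
  by constructor 1; rewrite e -r1r'; apply: ix_row.
(* Same column. Beyond column 1 the left neighbour of the upper box lies in between. In column 1 it
   is (2, r) if row r has a second box, and otherwise (1, r.+1), unless that is the upper box, which
   then is in the same chain. *)
case: k IHk b b' => [|k] IHk b b'.
  have [p|] := ltnP 1 (part r).
    have b2 : is_box 2 r by move: b; rewrite /is_box p; lia.
    constructor 3; exists 2, r; split=> //; first exact: below_row.
    exact: below_up.
  move=> p; move: rr'; rewrite leq_eqVlt => /orP[/eqP rr'|rr'].
    constructor 2; rewrite -rr' in b' *; split; last exact: below_column.
    rewrite /ix !root1 (_ : rows_from _ r = rows_from (fun y => 1 < part y) r.+1) //.
    case/and3P: b => _ rl _.
    by rewrite /rows_from (_ : l.+1 - r = (l.+1 - r.+1).+1) /= ?ltnNge ?p //; lia.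
  have b1 : is_box 1 r.+1 by rewrite /is_box part_gt0 //; case/and3P: b' => _; lia.
  by constructor 3; exists 1, r.+1; split=> //; apply: below_column.
constructor 3; have b1 : is_box k.+1 r' by apply: is_box_left b'.
exists k.+1, r'; split=> //; first exact: below_up.
exact: below_row.
Qed.

Lemma generic_lt t k r k' r' : generic t -> is_box k r -> is_box k' r' ->
  (k, r) != (k', r') -> r <= r' -> ix k r <= ix k' r' -> t (k, r) < t (k', r').
Proof.
move=> gt b b' ne; rewrite leq_eqVlt => /orP[/eqP e|rr'] le.
  rewrite -e in b' ne le *; case: gt => gt _ _.
  case: (ltngtP k k') => [lt|lt|kk']; last by rewrite kk' eqxx in ne.
    by apply: gt => //; case/andP: b.
  by have := ix_row (proj1 (andP b')) lt b; lia.
case: (box_trichotomy b b' rr') => [lt|[_ [_ _ H]]|[x [y [_ [_ _ H1] [_ _ H2]]]]]; first by lia.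
  exact: H.
exact: ltn_trans (H1 t gt) (H2 t gt).
Qed.

Lemma ix_inj k k' r : is_box k r -> is_box k' r -> ix k r = ix k' r -> k = k'.
Proof.
move=> b b' e; case: (ltngtP k k') => // lt.
  by have := ix_row (proj1 (andP b)) lt b'; lia.
by have := ix_row (proj1 (andP b')) lt b; lia.
Qed.

(** The weight 2 of a row makes one step up outweigh one step to the right. *)
Lemma generic_ex : exists t, generic t.
Proof. by exists (fun b => b.2 * 2 + b.1); split=> [k k' r _ lt _|k r r' _ _ lt|k r r' _ _ _ lt] /=; lia. Qed.

Lemma box_gap k r k' r' : is_box k r -> is_box k' r' -> r < r' -> ix k r < ix k' r' ->
  exists x y, [/\ is_box x y, (x, y) != (k, r), (x, y) != (k', r'),
    (r <= y) && (ix k r <= ix x y) & (y <= r') && (ix x y <= ix k' r')].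
Proof.
move=> b b' rr' lt; case: (box_trichotomy b b' rr') => [|[]|]; try lia.
move=> [x [y [bxy [/= r1 i1 t1] [/= r2 i2 t2]]]]; have [t gt] := generic_ex.
exists x, y; split; rewrite ?r1 ?r2 ?i1 ?i2 //.
  by apply/eqP => e; have := t1 t gt; rewrite e ltnn.
by apply/eqP => e; have := t2 t gt; rewrite e ltnn.
Qed.

Lemma ix_root k r k' r' : is_box k r -> is_box k' r' -> ix k r = ix k' r' ->
  root k r = root k' r'.
Proof.
move=> b b' [] e; rewrite -(nth_index (0, 0) (root_BB b)) e.
by rewrite nth_index // root_BB.
Qed.

Lemma ix_col_inj k r r' : 1 < k -> is_box k r -> is_box k r' -> ix k r = ix k r' -> r = r'.
Proof.
move=> k1 b b' e; case: (ltngtP r r') => // lt.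
  by have [_] := ix_mono b b' lt; rewrite k1 e ltnn => /(_ isT).
by have [_] := ix_mono b' b lt; rewrite k1 e ltnn => /(_ isT).
Qed.

Lemma ix_col_le k r r' : is_box k r -> is_box k r' -> r <= r' -> ix k r <= ix k r'.
Proof.
move=> b b'; rewrite leq_eqVlt => /orP[/eqP -> //|lt].
by have [] := ix_mono b b' lt.
Qed.

(** Predecessors go back one column at a time, and the common root lies in column c or before, so
    the walk from (k, r) meets column c+1. *)
Lemma chain_column c r0 k r : 0 < c -> is_box c r0 -> is_box k r -> c < k ->
  ix k r = ix c r0 -> exists2 r', is_box c.+1 r' & ix c.+1 r' = ix c r0.
Proof.
move=> c0 bc; elim: k r => // k IHk r b; rewrite ltnS leq_eqVlt => /orP[/eqP ck|ck] e.
  by exists r; rewrite ck // -ck in e *.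
case: k IHk b ck e => // k IHk b ck e.
have := rows_fromP (fun y => k.+1 <= part y) r.+1.
case F: (rows_from _ r.+1) => [|r1 s1].
  move=> _; have := ix_root b bc e; rewrite rootSS F => /(congr1 fst) /=.
  by have := root_col c r0; lia.
move=> [rr1 pr1 _]; apply: (IHk r1) => //; first by rewrite /is_box pr1; lia.
by rewrite -e [RHS]/ix rootSS F.
Qed.

Lemma extend_chainP fuel (A Y : seq box) j c r0 :
  (forall k r, ((k, r) \in A) = is_box k r && (j <= ix k r)) ->
  last (0, 0) Y = (c, r0) -> is_box c r0 -> ix c r0 = j ->
  (forall k r, ((k, r) \in Y) = [&& is_box k r, ix k r == j & k <= c]) ->
  count (fun b => b \notin Y) A <= fuel ->
  forall k r, ((k, r) \in extend_chain fuel A Y) = is_box k r && (ix k r == j).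
Proof.
elim: fuel Y c r0 => [|fuel IH] Y c r0 memA lastY bc ixc memY cnt k r /=.
  rewrite memY; have [b|] := boolP (is_box k r) => //=; have [e|] := eqVneq (ix k r) j => //=.
  have : (k, r) \in Y.
    apply/negbNE/negP => nY; move: cnt; rewrite leqNgt -has_count => /hasP; apply.
    by exists (k, r); rewrite // memA b e leqnn.
  by rewrite memY b e eqxx /= => ->.
have c0 : 0 < c by case/andP: bc.
have memN b : (b \in next_boxes A Y) = [&& b \notin Y, b.1 == c.+1, b.2 < r0 & b \in A].
  by rewrite mem_sort mem_filter lastY -!andbA.
case N: (next_boxes A Y) => [|b s].
  rewrite memY; have [b|] := boolP (is_box k r) => //=; have [e|] := eqVneq (ix k r) j => //=.
  (* A chain that went on beyond column c would have a box in column c+1, and this box would be a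
     candidate. *)
  rewrite leqNgt; apply/negP => ck; have [|r' b' e'] := @chain_column c r0 k r c0 bc b ck.
    by rewrite e.
  have rlt : r' < r0.
    rewrite ltnNge; apply/negP => le.
    have bcr : is_box c r' by exact: (is_box_left c0 (leqnSn c) b').
    by have := ix_col_le bc bcr le; have := ix_right c0 b'; lia.
  have : (c.+1, r') \in next_boxes A Y; last by rewrite N.
  by rewrite memN memY memA b' e' ixc ltnn !eqxx leqnn rlt.
have : b \in next_boxes A Y by rewrite N mem_head.
rewrite memN; case: b N => x y N /= /and4P[nY /eqP xc yr0]; rewrite xc in N nY *.
rewrite memA => /andP[bxy jle].
(* At least j because the box is still in [A], and at most j by [ix_up]. *)
have exy : ix c.+1 y = j by have := ix_up c0 bxy bc yr0; lia.
apply: (IH _ c.+1 y) => //; first by rewrite last_rcons.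
  move=> k' r'; rewrite mem_rcons inE memY xpair_eqE [k' <= c.+1]leq_eqVlt ltnS.
  have [k'c|] := eqVneq k' c.+1 => //=; have [b'|nb'] := boolP (is_box k' r') => /=; last first.
    by rewrite orbF; apply: contraNF nb' => /eqP ->; rewrite k'c.
  have [e|ne] := eqVneq (ix k' r') j => /=; last first.
    by rewrite orbF; apply: contraNF ne => /eqP ->; rewrite k'c exy.
  rewrite k'c in b' e; rewrite (ix_col_inj _ b' bxy) ?eqxx //; by lia.
have sub b : (b \notin rcons Y (c.+1, y)) = (b \notin Y) && (b != (c.+1, y)).
  by rewrite mem_rcons inE negb_or andbC.
rewrite -ltnS; apply: leq_trans cnt.
have := count_predC (fun b => b == (c.+1, y)) [seq b <- A | b \notin Y].
rewrite !count_filter size_filter => <-.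
rewrite (@eq_count _ (predI (predC _) _) (fun b => b \notin rcons Y (c.+1, y))); last first.
  by move=> b; rewrite /= sub andbC.
suff : 0 < count (predI (fun b => b == (c.+1, y)) (fun b => b \notin Y)) A by lia.
rewrite -has_count; apply/hasP; exists (c.+1, y); first by rewrite memA bxy exy leqnn.
by rewrite /= eqxx.
Qed.

Lemma mem_first_column d d' k r :
  ((k, r) \in first_column_boxes d d') = (k == 1) && (d' < r <= d).
Proof.
apply/mapP/idP => [[y +] [-> ->]|/andP[/eqP -> h]].
  by rewrite mem_rev mem_iota eqxx; lia.
by exists r; rewrite // mem_rev mem_iota; lia.
Qed.

Lemma BB_col1 d : (1, d) \in BB -> d < l -> 1 < part d.
Proof. by rewrite mem_BB /in_BB /= => /andP[_ /orP[/eqP ->|//]]; rewrite ltnn. Qed.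

Lemma BB_box k r : (k, r) \in BB -> is_box k r.
Proof. by rewrite mem_BB mem_tcd => /andP[]. Qed.

(** The two alternatives are the first chain, which starts at the bottom, and a later one, which
    starts just above the previous box of [BB] in column 1. *)
Lemma first_column_ix d d' j k r : (1, d) \in BB -> ix 1 d = j ->
  (d' = 0 /\ j = 1) \/ [/\ (1, d') \in BB, d' < d & (ix 1 d').+1 = j] ->
  ((k, r) \in first_column_boxes d d') = [&& is_box k r, ix k r == j & k <= 1].
Proof.
move=> dB dj H; rewrite mem_first_column.
have bd := BB_box dB; have dl : d <= l by case/and3P: bd; lia.
have [->|k1] := eqVneq k 1 => /=; last first.
  by apply/esym/negbTE; apply/negP => /and3P[/and3P[k0 _ _] _ k1']; move: k1; rewrite eqn_leq k1' k0.
rewrite andbT; apply/idP/andP => [/andP[d'r rd]|[b /eqP e]].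
  have b : is_box 1 r by rewrite /is_box part_gt0 //; lia.
  split=> //; have le := ix_col_le b bd rd; rewrite dj in le.
  case: H => [[_ j1]|[d'B d'd d'j]].
    by rewrite eqn_leq le j1.
  have [_] := ix_mono (BB_box d'B) b d'r; rewrite (BB_col1 d'B) ?orbT; last by lia.
  by move=> /(_ isT); rewrite eqn_leq le; lia.
apply/andP; split; last first.
  rewrite leqNgt; apply/negP => dr; have [_] := ix_mono bd b dr.
  rewrite (BB_col1 dB) ?orbT; last by case/and3P: b; lia.
  by move=> /(_ isT); lia.
case: H => [[-> _]|[d'B d'd d'j]]; first by case/and3P: b; lia.
rewrite ltnNge; apply/negP => rd'; have := ix_col_le b (BB_box d'B) rd'; lia.
Qed.

(** [BB] is split after the last box treated, (b0, d'), at position [size pre]; as [ix] counts from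
    1, the next chain has number [(size pre).+2]. *)
Lemma chainsP bs A d' pre b0 : BB = rcons pre (b0, d') ++ bs ->
  (forall k r, ((k, r) \in A) = is_box k r && ((size pre).+2 <= ix k r)) ->
  size (chains A d' bs) = size bs /\
  forall m k r, m < size bs ->
    ((k, r) \in nth [::] (chains A d' bs) m) = is_box k r && (ix k r == (size pre).+2 + m).
Proof.
elim: bs A d' pre b0 => [|[b d] bs IHbs] A d' pre b0 BBE memA //=.
set j := (size pre).+2 in memA *.
have bdB : (b, d) \in BB by rewrite BBE mem_cat mem_head orbT.
have b0B : (b0, d') \in BB by rewrite BBE mem_cat mem_rcons mem_head.
have bbd := BB_box bdB.
have nthd : nth (0, 0) BB (size pre).+1 = (b, d).
  by rewrite BBE nth_cat size_rcons ltnn subnn.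
have nthb : nth (0, 0) BB (size pre) = (b0, d').
  by rewrite BBE nth_cat size_rcons ltnS leqnn nth_rcons ltnn eqxx.
have szB : (size pre).+1 < size BB by rewrite BBE size_cat size_rcons /=; lia.
have idxd : index (b, d) BB = (size pre).+1 by rewrite -nthd index_uniq // BB_uniq.
have idxb : index (b0, d') BB = size pre by rewrite -nthb index_uniq ?BB_uniq // ltnW.
have ixd : ix b d = j by rewrite /ix root_id // idxd.
have ixb : (ix b0 d').+1 = j by rewrite /ix root_id // idxb.
set Y0 := if b == 1 then _ else _.
have [c [r0 [lastY bc ixc memY]]] : exists c r0, [/\ last (0, 0) Y0 = (c, r0), is_box c r0,
    ix c r0 = j & forall k r, ((k, r) \in Y0) = [&& is_box k r, ix k r == j & k <= c]].
  rewrite /Y0; case: (eqVneq b 1) => [b1|b1].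
    rewrite b1 in bdB bbd idxd ixd.
    have b01 : b0 = 1.
      have [|lt|//] := ltngtP b0 1; first by have := BB_box b0B; case/and3P; lia.
      by have := @BB_index_lt (1, d) (b0, d') bdB b0B; rewrite lt idxd idxb => /(_ isT); lia.
    rewrite b01 in b0B ixb idxb; have d'd : d' < d.
      have [//|lt|e] := ltngtP d' d; last by rewrite e idxd in idxb; lia.
      by have := @BB_index_lt (1, d) (1, d') bdB b0B; rewrite /= lt idxd idxb => /(_ isT); lia.
    exists 1, d'.+1.
    have mem k r : ((k, r) \in first_column_boxes d d') = [&& is_box k r, ix k r == j & k <= 1].
      by apply: first_column_ix => //; right.
    have : (1, d'.+1) \in first_column_boxes d d' by rewrite mem_first_column; lia.
    rewrite mem => /and3P[h1 /eqP h2 _]; split=> //.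
    rewrite /first_column_boxes (_ : d - d' = (d - d'.+1).+1); last by lia.
    by rewrite /= rev_cons map_rcons last_rcons.
  exists b, d; split=> // k r; rewrite inE; apply/eqP/and3P => [[-> ->]|[bk /eqP e le]].
    by rewrite bbd ixd eqxx leqnn.
  have := ix_root bk bbd; rewrite e ixd (root_id bdB) => /(_ erefl) rt.
  have kb : k = b by have := root_col k r; rewrite rt /=; lia.
  rewrite kb in bk e *; congr (_, _); apply: ix_col_inj bk bbd _; last by rewrite e.
  by have := BB_box bdB; case/and3P; lia.
set Y := extend_chain _ A Y0.
have memYj : forall k r, ((k, r) \in Y) = is_box k r && (ix k r == j).
  by apply: (extend_chainP memA lastY bc ixc memY); apply: count_size.
have [] := IHbs [seq c <- A | c \notin Y] d (rcons pre (b0, d')) b.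
- by rewrite BBE -!cats1 -!catA.
- move=> k r; rewrite mem_filter memA memYj size_rcons.
  by case: (is_box k r) => //=; rewrite -/j; lia.
move=> -> H; split=> // -[|m] k r; first by rewrite /= memYj addn0.
by rewrite ltnS => /H; rewrite /= => ->; rewrite size_rcons addnS.
Qed.

Lemma YsP : size (Ys alpha) = size BB /\
  forall m k r, m < size BB -> ((k, r) \in nth [::] (Ys alpha) m) = is_box k r && (ix k r == m.+1).
Proof.
rewrite /Ys; case E: BB => [|[b d] bs] //=.
have bB : (b, d) \in BB by rewrite E mem_head.
have b1 : is_box 1 1 by rewrite /is_box part_gt0 l_gt0.
have bE : b = 1.
  have [|lt|//] := ltngtP b 1; first by have := BB_box bB; case/and3P; lia.
  have := @BB_index_lt (root 1 1) (b, d) (root_BB b1) bB; rewrite root1 lt => /(_ isT).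
  by rewrite [index (b, d) _](_ : _ = 0) // E /= eqxx.
rewrite bE in bB E *.
have ixd : ix 1 d = 1 by rewrite /ix root_id // E /= eqxx.
have memY k r : ((k, r) \in first_column_boxes d 0) = is_box k r && (ix k r == 1).
  rewrite (first_column_ix k r bB ixd); last by left.
  have [bk|//] := boolP (is_box k r); have [e|//] := eqVneq (ix k r) 1 => /=.
  rewrite leqNgt; apply/negP => k1; have := @ix_row 1 k r isT k1 bk.
  by rewrite e.
have [] := @chainsP bs [seq c <- tcd | c \notin first_column_boxes d 0] d [::] 1.
- by rewrite E.
- move=> k r; rewrite mem_filter memY mem_tcd /=; case: (is_box k r) => //=.
  by rewrite /ix; lia.
move=> -> H; split=> // -[|m] k r; first by rewrite /= memY.
by rewrite ltnS => /H; rewrite /= => ->.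
Qed.

Definition pt (b : box) : box := (b.2, ix b.1 b.2).

Lemma pt_inj : {in tcd &, injective pt}.
Proof.
move=> [k r] [k' r']; rewrite !mem_tcd /pt /= => b b' [rr' e].
by rewrite -rr' in b' e *; rewrite (ix_inj b b' (congr1 S e)).
Qed.

Lemma perm_canonical_diagram : perm_eq (canonical_diagram alpha) [seq pt b | b <- tcd].
Proof.
have [szY memY] := YsP.
apply: uniq_perm.
- rewrite filter_uniq // allpairs_uniq ?iota_uniq //.
  by move=> [a b] [c d] _ _ /= [-> ->].
- by rewrite map_inj_in_uniq ?tcd_uniq //; exact: pt_inj.
move=> [i j]; rewrite mem_filter /=; apply/andP/mapP.
  move=> [/hasP[[k r] mem1 /mapP[x _ [kx ri]]] /allpairsP[[i' j'] /= [_ + [_ jj]]]].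
  rewrite mem_iota -jj szY => hj; move: mem1; rewrite /= memY; last by lia.
  move=> /andP[b /eqP e]; exists (k, r); first by rewrite mem_tcd.
  by rewrite /pt /= e ri prednK //; lia.
move=> [[k r]]; rewrite mem_tcd /pt /= => b [-> ->].
have lt : index (root k r) BB < size BB by rewrite index_mem root_BB.
have /and3P[k0 rl kp] := b; split.
  apply/hasP; exists (k, r); first by rewrite memY // b eqxx.
  by apply/mapP; exists k; rewrite // mem_iota; lia.
apply/allpairsP; exists (r, ix k r); split=> //=; rewrite mem_iota; first by lia.
by rewrite szY /ix add1n ltnS /=; apply: lt.
Qed.
End Composition.

Lemma pairwise_rows (R : rel box) (f : nat -> seq nat) m k :
  (forall i, pairwise (fun a b => R (a, i) (b, i)) (f i)) ->
  (forall i i' j j', i < i' -> R (j, i) (j', i')) ->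
  pairwise R [seq (j, i) | i <- iota m k, j <- f i].
Proof.
move=> Rrow Rcol; elim: k m => //= k IHk m; rewrite pairwise_cat IHk pairwise_map.
rewrite (_ : pairwise _ (f m)) ?andbT; last exact: Rrow.
apply/allrelP => b c /mapP[j _ ->] /allpairsPdep[i [j' [+ _ ->]]].
by rewrite mem_iota => /andP[mi _]; apply: Rcol.
Qed.

Lemma uniq_map_in_inj (T U : eqType) (f : T -> U) s :
  uniq [seq f x | x <- s] -> {in s &, injective f}.
Proof.
move=> us x y xs ys e; have ux : index x s < size s by rewrite index_mem.
have uy : index y s < size s by rewrite index_mem.
have := nth_uniq (f x) _ _ us; rewrite size_map => /(_ _ _ ux uy).
rewrite !(nth_map x) // !nth_index // e eqxx => /esym/eqP ei.
by rewrite -(nth_index x xs) ei nth_index.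
Qed.

(** * The canonical class as the increasing fillings of the diagram *)

Section CanonicalClass.
Variable alpha : seq nat.
Hypothesis alpha_pos : all (leq 1) alpha.
Hypothesis alpha_nil : alpha != [::].
Local Notation tcd := (tcd alpha).
Local Notation is_box := (is_box alpha).

Lemma canonical_filling_lt k r r' : is_box k r -> is_box k r' ->
  (canonical_filling alpha (k, r) < canonical_filling alpha (k, r')) = (r < r').
Proof.
move=> b b'; rewrite /canonical_filling ltnS.
have lt x y : is_box k x -> is_box k y -> x < y -> index (k, x) tcd < index (k, y) tcd.
  move=> bx b_y xy; rewrite ltnNge leq_eqVlt; apply/negP => /orP[/eqP e|lt].
    have : nth (0, 0) tcd (index (k, y) tcd) = (k, y) by rewrite nth_index // mem_tcd.
    by rewrite e nth_index ?mem_tcd // => -[e']; rewrite e' ltnn in xy.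
  have pw : pairwise (fun b c : box => b.2 <= c.2) tcd.
    by apply: pairwise_rows => [i|i i' j j' /ltnW //]; elim: (iota _ _) => //= a s ->; rewrite andbT; apply/allP => c _ /=.
  have := pairwiseP (0, 0) pw (index (k, y) tcd) (index (k, x) tcd).
  rewrite !inE !index_mem !mem_tcd. rewrite bx b_y lt !nth_index ?mem_tcd //= => /(_ isT isT isT).
  by rewrite leqNgt xy.
case: (ltngtP r r') => [/lt -> //|rr'|->]; last by rewrite ltnn.
by rewrite ltnNge ltnW // lt.
Qed.

Lemma canonical_class_generic t : in_canonical_class alpha t <->
  perm_eq [seq t b | b <- tcd] (iota 1 (sumn alpha)) /\ generic alpha t.
Proof.
split=> [[[pt row _ triple] eqv]|[pt gt]].
  have col k r r' : is_box k r -> is_box k r' -> r < r' -> t (k, r) < t (k, r').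
    by move=> b b' lt; rewrite (eqv k r r') ?mem_tcd // canonical_filling_lt.
  have injt : {in tcd &, injective t}.
    by apply: uniq_map_in_inj; rewrite (perm_uniq pt) iota_uniq.
  split=> //; split=> // [k k' r k0 kk' b|k r r' k0 b b' rr'].
    by apply: row; rewrite ?mem_tcd //; apply: is_box_left b => //; exact: ltnW.
  rewrite ltnNge leq_eqVlt; apply/negP => /orP[/eqP e|lt].
    have := injt (k, r') (k.+1, r); rewrite !mem_tcd => /(_ b' b e) [] ?; lia.
  (* The triple condition would put in column k+1, above row r, an entry smaller than that of (k+1,
     r), against the increasing columns. *)
  have [||] := triple r r' k rr' _ _ lt; rewrite ?mem_tcd // => b2 lt2.
  by have := col k.+1 r r' b b2 rr'; lia.
case: gt => row col up; split; first split=> //.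
- by move=> x x' y; rewrite !mem_tcd => b b' xx'; apply: row => //; case/andP: b.
- by move=> y y'; rewrite !mem_tcd => b b' yy'; apply: col.
- move=> r r' k rr'; rewrite !mem_tcd => b b' lt; have k0 : 0 < k by case/andP: b'.
  by have := up k r r' k0 b b' rr'; lia.
move=> x y y'; rewrite !mem_tcd => b b'; rewrite canonical_filling_lt //.
case: (ltngtP y y') => [lt|lt|->]; [exact: col| |exact: ltnn].
by apply/negbTE; rewrite -leqNgt ltnW // col.
Qed.

Definition RB_boxes : seq box :=
  [seq (j, i) | i <- iota 1 (size alpha), j <- rev (iota 1 (part alpha i))].

Lemma word_RBE t : word_RB alpha t = [seq t b | b <- RB_boxes].
Proof.
rewrite /word_RB /RB_boxes; elim: (iota _ _) => //= i s ->.
by rewrite map_cat -map_comp.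
Qed.

Lemma mem_RB_boxes : RB_boxes =i tcd.
Proof.
move=> [k r]; apply/allpairsPdep/allpairsPdep => -[i [j [iI jJ e]]];
  by exists i, j; split; rewrite // ?mem_rev // -mem_rev.
Qed.

Lemma perm_RB_boxes : perm_eq RB_boxes tcd.
Proof.
apply: uniq_perm; [|exact: tcd_uniq|exact: mem_RB_boxes].
apply: allpairs_uniq_dep => [||[i j] [i' j'] _ _ /= [-> ->] //]; first exact: iota_uniq.
by move=> i _; rewrite rev_uniq iota_uniq.
Qed.

(** By [ix_row] the chain number grows along a row of tcd(alpha), so reading the row from right to
    left reads a column of the diagram from top to bottom. *)
Lemma sort_RB_order (D : seq box) : perm_eq D [seq pt alpha b | b <- tcd] ->
  sort RB_order D = [seq pt alpha b | b <- RB_boxes].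
Proof.
move=> pD; apply: (sorted_eq RB_order_trans).
- by move=> [a b] [c d]; rewrite /RB_order /= => h; congr (_, _); lia.
- exact/sort_sorted/RB_order_total.
- rewrite sorted_map.
  pose R (b c : box) := (b.2 < c.2) || ((b.2 == c.2) && (c.1 <= b.1)).
  have Rtr : transitive R by move=> [a b] [c d] [e f]; rewrite /R /=; lia.
  have : sorted R RB_boxes.
    rewrite sorted_pairwise //; apply: pairwise_rows => [i|i i' j j' ii']; last by rewrite /R ii'.
    have : sorted geq (rev (iota 1 (part alpha i))) by rewrite rev_sorted; exact: iota_sorted.
    rewrite sorted_pairwise; last by move=> x y z; rewrite /geq /=; lia.
    by apply: sub_pairwise => a b /= ab; rewrite /R /= ltnn eqxx.
  apply: sub_in_sorted (allss _) => -[k r] [k' r']; rewrite !mem_RB_boxes !mem_tcd.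
  move=> b b'; rewrite /R /relpre /RB_order /pt /= => /orP[-> //|/andP[/eqP e kk']].
  rewrite e eqxx ltnn /=; rewrite e in b; move: kk'; rewrite leq_eqVlt => /orP[/eqP -> //|lt].
  by rewrite ltnW //; apply: ix_row => //; case/andP: b'.
rewrite perm_sort (perm_trans pD) // perm_map // perm_sym.
exact: perm_RB_boxes.
Qed.

Variable n : nat.
Hypothesis alpha_sum : sumn alpha = n.+1.
Local Notation D := (canonical_diagram alpha).

Lemma canonical_diagram_uniq : uniq D.
Proof.
rewrite (perm_uniq (perm_canonical_diagram alpha_pos alpha_nil)).
by rewrite map_inj_in_uniq ?tcd_uniq //; exact: pt_inj.
Qed.

Lemma canonical_diagram_size : size D = n.+1.
Proof.
by rewrite (perm_size (perm_canonical_diagram alpha_pos alpha_nil)) size_map size_tcd.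
Qed.

Lemma canonical_diagram_gap b c : b \in D -> c \in D -> b.1 < c.1 -> b.2 < c.2 ->
  exists e, [/\ e \in D, e != b, e != c, box_le b e & box_le e c].
Proof.
have mD := perm_mem (perm_canonical_diagram alpha_pos alpha_nil).
rewrite !mD => /mapP[[k r] bt ->] /mapP[[k' r'] ct ->]; rewrite /pt /= => rr' ii'.
have bb := bt; have bc := ct; rewrite !mem_tcd in bb bc.
have [x [y [bxy ne1 ne2 h1 h2]]] := box_gap alpha_pos alpha_nil bb bc rr' ii'.
have inj := pt_inj alpha_pos alpha_nil; have xyt : (x, y) \in tcd by rewrite mem_tcd.
exists (pt alpha (x, y)); split; rewrite ?mD ?map_f //.
  by apply: contra ne1 => /eqP e; apply/eqP/inj.
by apply: contra ne2 => /eqP e; apply/eqP/inj.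
Qed.

Lemma size_RB_boxes : size RB_boxes = n.+1.
Proof. by rewrite (perm_size perm_RB_boxes) size_tcd. Qed.

Lemma RB_boxes_uniq : uniq RB_boxes.
Proof. by rewrite (perm_uniq perm_RB_boxes) tcd_uniq. Qed.

Lemma mem_canonical_words (s : 'S_n.+1) : reflect
  (forall p q, p != q -> box_le (point D RB_order p) (point D RB_order q) -> s p < s q)
  (s \in canonical_words alpha n).
Proof.
pose bx (p : 'I_n.+1) := nth (0, 0) RB_boxes p.
have bx_box p : is_box (bx p).1 (bx p).2.
  by rewrite -mem_tcd -surjective_pairing -mem_RB_boxes mem_nth // size_RB_boxes.
have KE p : point D RB_order p = pt alpha (bx p).
  rewrite /point sort_RB_order ?perm_canonical_diagram //.
  by rewrite (nth_map (0, 0)) // size_RB_boxes.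
have olE t p : oneline s = word_RB alpha t -> (s p).+1 = t (bx p).
  rewrite word_RBE => /(congr1 (fun w => nth 0 w p)).
  rewrite (nth_map (0, 0)) ?size_RB_boxes // /oneline (nth_map ord0) ?size_enum_ord //.
  by rewrite nth_ord_enum.
apply: (iffP idP) => [|H].
  rewrite inE => /boolp.asboolP[t /canonical_class_generic[_ gt] ol] p q pq.
  rewrite !KE /box_le /pt /= => /andP[le1 le2]; rewrite -ltnS !(olE t) //.
  rewrite [bx p]surjective_pairing [bx q]surjective_pairing.
  apply: (generic_lt alpha_pos alpha_nil gt) => //.
  rewrite -!surjective_pairing nth_uniq ?size_RB_boxes ?RB_boxes_uniq //.
(* The filling read back from [s], with values shifted to start at 1; the default 0 only concerns
   boxes outside tcd(alpha). *)
pose t b := if insub (index b RB_boxes) is Some p then (s p).+1 else 0.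
have tE p : t (bx p) = (s p).+1.
  rewrite /t /bx index_uniq ?size_RB_boxes ?RB_boxes_uniq //.
  by rewrite insubT // => lt; congr (s _).+1; apply: val_inj.
have ol : oneline s = word_RB alpha t.
  rewrite word_RBE /oneline; apply: (@eq_from_nth _ 0).
    by rewrite size_map size_enum_ord size_map size_RB_boxes.
  rewrite size_map size_enum_ord => i il; rewrite (nth_map ord0) ?size_enum_ord //.
  rewrite (nth_map (0, 0)) ?size_RB_boxes // -[ i ]/(nat_of_ord (Ordinal il)) -/(bx _) tE.
  by rewrite nth_ord_enum.
have surj k r : is_box k r -> exists p, bx p = (k, r).
  rewrite -mem_tcd -mem_RB_boxes => b; have lt : index (k, r) RB_boxes < n.+1.
    by rewrite -size_RB_boxes index_mem.
  by exists (Ordinal lt); rewrite /bx nth_index.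
have lt k r k' r' : is_box k r -> is_box k' r' -> (k, r) != (k', r') -> r <= r' ->
    ix alpha k r <= ix alpha k' r' -> t (k, r) < t (k', r').
  move=> /surj[p ep] /surj[q eq] ne le1 le2; rewrite -ep -eq !tE ltnS; apply: H.
    by apply: contraNneq ne => pq; rewrite -ep -eq pq.
  by rewrite !KE ep eq /box_le /pt /= le1.
rewrite inE; apply/boolp.asboolP; exists t => //; apply/canonical_class_generic; split.
  have /(perm_map t) := perm_RB_boxes; rewrite perm_sym => /perm_trans; apply.
  rewrite -word_RBE -ol alpha_sum.
  apply: uniq_perm; [|exact: iota_uniq|].
    rewrite (map_inj_uniq (f := fun p => (s p).+1)); first exact: enum_uniq.
    by move=> p q [/ord_inj/perm_inj].
  move=> x; rewrite mem_iota; apply/mapP/andP => [[p _ ->]|[x0 xn]].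
    by split=> //; rewrite add1n ltnS.
  have xn' : x.-1 < n.+1 by lia.
  by exists ((s^-1)%g (Ordinal xn')); rewrite ?mem_enum // permKV /= prednK.
split=> [k k' r k0 kk' b|k r r' b b' rr'|k r r' k0 b b' rr'].
- have b1 : is_box k r by apply: is_box_left b => //; exact: ltnW.
  apply: lt => //; first by rewrite xpair_eqE; apply/nandP; left; rewrite neq_ltn kk'.
  by apply/ltnW/ix_row.
- apply: lt => //; [|exact: ltnW|].
    by rewrite xpair_eqE; apply/nandP; right; rewrite neq_ltn rr'.
  by apply: ix_col_le => //; exact: ltnW.
apply: lt => //; [|exact: ltnW|exact: ix_up].
by rewrite xpair_eqE; apply/nandP; right; rewrite neq_ltn rr'.
Qed.
End CanonicalClass.

Theorem corollary5p17 (R : realType) (n : nat) (alpha : seq nat)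
    (halpha : is_composition n.+1 alpha) :
  let D := canonical_diagram alpha in
  is_injective_hull
    (B R[i] (intervalL
       (w0 (DesL (perm_of_word n (word_BL D (row_filling D)))))
       (w1 (comp_set n (row_counts D)))))
    (S_hat alpha R[i] n).
Proof.
have /andP[pos /eqP sum] := halpha.
have nil : alpha != [::] by apply: contra_eq_neq sum => ->.
apply: diagram_hull.
- exact: canonical_diagram_uniq.
- exact: canonical_diagram_size.
- exact: mem_canonical_words.
- exact: canonical_diagram_gap.
Qed.
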